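(* Let $r\in\mathbb{N}_{\ge 1}$ and let $M=(M_p)_{p\in\mathbb{N}}$ be a sequence of positive real numbers with $M\in\mathcal{LC}$ and $\lim_{p\to\infty}\left(\frac{(M_p)^{1/r}}{p!}\right)^{1/p}=\infty$. Then the following are equivalent: (i) The map $\mathcal{B}^r:\mathcal{D}_{r,\{M\}}([-1,1])\to\Lambda_{\{M\}}$, $f\mapsto(f^{(rj)}(0))_{j\in\mathbb{N}}$, is surjective. (ii) The map $\mathcal{B}^r:\mathcal{D}_{r,(M)}([-1,1])\to\Lambda_{(M)}$, $f\mapsto(f^{(rj)}(0))_{j\in\mathbb{N}}$, is surjective. (iii) There exists $s\in\mathbb{N}_{>0}$ such that $\sup_{p\in\mathbb{N}_{>0}}\frac{(\lambda^{M,M}_{p,s})^{1/r}}{p}\sum_{k\ge p}\left(\frac{1}{\mu_k}\right)^{1/r}<\infty$. (iv) $\sup_{p\in\mathbb{N}_{>0}}\frac{(\mu_p)^{1/r}}{p}\sum_{k\ge p}\left(\frac{1}{\mu_k}\right)^{1/r}<\infty$.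
   Context: $\mathbb{N}=\{0,1,2,\dots\}$, $\mathbb{N}_{>0}=\{1,2,\dots\}$. For a sequence $M$ of positive reals put $\mu_p=M_p/M_{p-1}$ for $p\ge1$, $\mu_0=1$. $\mathcal{LC}$ is the set of all positive sequences $M$ that are normalized ($1=M_0\le M_1$), log-convex ($M_j^2\le M_{j-1}M_{j+1}$ for all $j\ge 1$), and satisfy $\lim_{k\to\infty}(M_k)^{1/k}=\infty$. For $p,s\in\mathbb{N}_{>0}$, $\lambda^{M,M}_{p,s}:=\sup_{0\le j<p}\left(\frac{M_p}{s^pM_j}\right)^{1/(p-j)}$. Finiteness of the suprema in (iii) and (iv) includes convergence of the series. $\Lambda_{\{M\}}$ (resp. $\Lambda_{(M)}$) is the set of all complex sequences $(a_p)_{p\in\mathbb{N}}$ such that for some $h>0$ (resp. for every $h>0$) one has $\sup_{p\in\mathbb{N}}\frac{|a_p|}{h^pM_p}<\infty$. $\mathcal{D}_{r,\{M\}}([-1,1])$ (resp. $\mathcal{D}_{r,(M)}([-1,1])$) is the set of all $\mathcal{C}^\infty$ functions $f:\mathbb{R}\to\mathbb{C}$ with support in $[-1,1]$, with $f^{(rn+j)}(0)=0$ for all $n\in\mathbb{N}$ and $j\in\{1,\dots,r-1\}$, and such that for some $h>0$ (resp. for every $h>0$) one has $\sup_{n\in\mathbb{N},x\in\mathbb{R}}\frac{|f^{(rn)}(x)|}{h^nM_n}<\infty$. *)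

(* Defs.v *)
From Stdlib Require Import Reals.
From Coquelicot Require Import Coquelicot.

Open Scope R_scope.

Definition mu (M : nat -> R) (p : nat) : R :=
  match p with
  | O => 1
  | S q => M p / M q
  end.

Record LC (M : nat -> R) : Prop := {
  LC_pos : forall p, 0 < M p;
  LC_norm0 : M O = 1;
  LC_norm1 : 1 <= M 1%nat;
  LC_logconvex : forall j, (1 <= j)%nat -> M j ^ 2 <= M (j - 1)%nat * M (j + 1)%nat;
  LC_root : is_lim_seq (fun k => Rpower (M k) (/ INR k)) p_infty
}.

(* For p >= 1 the supremum is over a nonempty finite set, hence a real number;
   [lambda M 0 s] is meaningless and never used. *)
Definition lambda (M : nat -> R) (p s : nat) : R :=
  real (Lub_Rbar (fun y => exists j, (j < p)%nat /\
    y = Rpower (M p / (INR s ^ p * M j)) (/ INR (p - j)))).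

(* sup_{p >= 1} c_p^{1/r} / p * sum_{k >= p} (1 / mu_k)^{1/r} < oo.
   [Series] is total, so convergence of the series is required separately. *)
Definition gamma_cond (r : nat) (M c : nat -> R) : Prop :=
  exists A, forall p, (1 <= p)%nat ->
    ex_series (fun k => Rpower (/ mu M (p + k)) (/ INR r)) /\
    Rpower (c p) (/ INR r) / INR p
      * Series (fun k => Rpower (/ mu M (p + k)) (/ INR r)) <= A.

Definition Lambda_h (M : nat -> R) (h : R) (a : nat -> C) : Prop :=
  exists A, forall p, Cmod (a p) / (h ^ p * M p) <= A.

Definition Lambda_Roumieu (M : nat -> R) (a : nat -> C) : Prop :=
  exists h, 0 < h /\ Lambda_h M h a.

Definition Lambda_Beurling (M : nat -> R) (a : nat -> C) : Prop :=
  forall h, 0 < h -> Lambda_h M h a.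

(* Coquelicot's total derivative operators [Derive] and [Derive_n] only apply
   to real-valued functions, so derivatives of f : R -> C are taken on the real
   and imaginary parts; [smooth_is_derive] and [is_derive_smooth] compare this
   with [is_derive] in the real normed module C. *)
Definition CDerive_n (f : R -> C) (n : nat) (x : R) : C :=
  (Derive_n (fun t => Re (f t)) n x, Derive_n (fun t => Im (f t)) n x).

Definition smooth (f : R -> C) : Prop :=
  forall n x, ex_derive_n (fun t => Re (f t)) n x /\
              ex_derive_n (fun t => Im (f t)) n x.

Lemma is_derive_C (f : R -> C) (x : R) (l : C) :
  is_derive (K := R_AbsRing) (V := C_R_NormedModule) f x l <->
  is_derive (fun t => Re (f t)) x (Re l) /\ is_derive (fun t => Im (f t)) x (Im l).
Proof.
split.
- intros H; split.
  + exact (filterdiff_comp' f fst x _ _ H (filterdiff_linear _ is_linear_fst)).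
  + exact (filterdiff_comp' f snd x _ _ H (filterdiff_linear _ is_linear_snd)).
- intros [Hr Hi].
  apply (filterdiff_ext (V := C_R_NormedModule) (fun t => (Re (f t), Im (f t)))).
  { intros t; destruct (f t); reflexivity. }
  refine (filterdiff_comp'_2 (W := C_R_NormedModule) (fun t => Re (f t))
    (fun t => Im (f t)) (fun u v => (u, v)) x _ _ (fun u v => (u, v)) Hr Hi _).
  apply (filterdiff_linear (V := C_R_NormedModule) (fun t : R * R => (fst t, snd t))).
  apply (is_linear_prod (U := R_NormedModule) (V := R_NormedModule) fst snd
    is_linear_fst is_linear_snd).
Qed.

Lemma smooth_is_derive (f : R -> C) : smooth f ->
  (forall x, CDerive_n f 0 x = f x) /\
  forall n x, is_derive (K := R_AbsRing) (V := C_R_NormedModule)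
                (CDerive_n f n) x (CDerive_n f (S n) x).
Proof.
intros H; split.
- intros x; unfold CDerive_n; simpl; destruct (f x); reflexivity.
- intros n x; apply is_derive_C; destruct (H (S n) x) as [H1 H2]; split;
    apply Derive_correct; assumption.
Qed.

Lemma is_derive_smooth (f : R -> C) (F : nat -> R -> C) :
  (forall x, F O x = f x) ->
  (forall n x, is_derive (K := R_AbsRing) (V := C_R_NormedModule)
                 (F n) x (F (S n) x)) ->
  smooth f /\ forall n x, CDerive_n f n x = F n x.
Proof.
intros H0 HS.
assert (HR : forall n x, Derive_n (fun t => Re (f t)) n x = Re (F n x)).
{ induction n as [|n IH]; intros x; simpl; [now rewrite H0|].
  rewrite (Derive_ext _ _ x IH); apply is_derive_unique.
  now apply is_derive_C. }
assert (HI : forall n x, Derive_n (fun t => Im (f t)) n x = Im (F n x)).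
{ induction n as [|n IH]; intros x; simpl; [now rewrite H0|].
  rewrite (Derive_ext _ _ x IH); apply is_derive_unique.
  now apply is_derive_C. }
split.
- intros [|n] x; simpl; [tauto|]; split.
  + exists (Re (F (S n) x)); apply (is_derive_ext (fun t => Re (F n t))).
    * intros t; now rewrite HR.
    * now apply is_derive_C.
  + exists (Im (F (S n) x)); apply (is_derive_ext (fun t => Im (F n t))).
    * intros t; now rewrite HI.
    * now apply is_derive_C.
- intros n x; unfold CDerive_n; rewrite HR, HI; destruct (F n x); reflexivity.
Qed.

Definition D_h (r : nat) (M : nat -> R) (h : R) (f : R -> C) : Prop :=
  exists A, forall n x, Cmod (CDerive_n f (r * n) x) / (h ^ n * M n) <= A.

(* [-1, 1] being closed, it contains the support of f as soon as it contains
   every point where f does not vanish. *)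
Record D_base (r : nat) (f : R -> C) : Prop := {
  D_smooth : smooth f;
  D_supp : forall x, f x <> 0%C -> -1 <= x <= 1;
  D_flat : forall n j, (1 <= j < r)%nat -> CDerive_n f (r * n + j) 0 = 0%C
}.

Definition D_Roumieu (r : nat) (M : nat -> R) (f : R -> C) : Prop :=
  D_base r f /\ exists h, 0 < h /\ D_h r M h f.

Definition D_Beurling (r : nat) (M : nat -> R) (f : R -> C) : Prop :=
  D_base r f /\ forall h, 0 < h -> D_h r M h f.

Definition Borel (r : nat) (f : R -> C) (j : nat) : C := CDerive_n f (r * j) 0.

Definition Borel_surjective (r : nat) (X : (R -> C) -> Prop)
    (Y : (nat -> C) -> Prop) : Prop :=
  forall a, Y a -> exists f, X f /\ forall j, Borel r f j = a j.

Lemma Borel_Roumieu r M f : D_Roumieu r M f -> Lambda_Roumieu M (Borel r f).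
Proof.
intros [_ [h [h0 [A HA]]]]; exists h; split; [exact h0|].
exists A; intros p; apply HA.
Qed.

Lemma Borel_Beurling r M f : D_Beurling r M f -> Lambda_Beurling M (Borel r f).
Proof.
intros [_ H] h h0; destruct (H h h0) as [A HA]; exists A; intros p; apply HA.
Qed.

(* Main.v *)
Require Import Defs.
From Stdlib Require Import Reals Factorial.
From Coquelicot Require Import Coquelicot.
From Stdlib Require Import PSeries_reg Lra Lia Classical ClassicalEpsilon.
Open Scope R_scope.

(** Put [m k = (mu M k)^(1/r)]; condition (iv) says that
    [m p * sum_(k >= p) 1 / m k] is at most a constant times [p].

    Sufficiency. Averaging a trapezoid over intervals of half-widths [1 / m k] gives a
    cutoff function of size [n / m n] adapted to the weights, and (iv) is what allows
    the widths to be as large as needed. Multiplying it by [x^(rn) / (rn)!] yields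
    functions dual to the Borel map, which are dilated and summed. In the Beurling case,
    [m] is first replaced by [m / theta] with [theta] increasing to infinity so slowly
    that (iv) survives and the given data are still controlled.

    Necessity. If (iv) fails, there are a very lacunary sequence of indices [j] and
    bounds [N] such that [m j * sum_(2j < k <= N) 1 / m k] is much larger than [j].
    Prescribe nonzero derivatives only at the orders [2rj]. For a preimage [f], the
    function [f^(2rj) - f^(2rj)(0)] is flat at [0] up to order [r (N - 2j)], hence
    exponentially small, by an argument of Bang, on an interval much longer than
    [j / m j]. There [f^(rj)] is at least half its Taylor monomial at [0], which
    violates the bound on [f^(rj)].

    The equivalence of (iii) and (iv) holds because the [lambda] of (iii) at [2q] lies
    between [mu M q / s^2] and [mu M (2 q)]. *)

(** * Finite sums and products, uniform limits *)

(** Sufficiency: a cutoff of size n / m n makes x^(rn) / (rn)! at most e^(Cn) / (m n)^(rn) on its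
    support, because n^d / d! is a term of the series of e^n. So the factorial costs only a
    geometric factor, which one fixed dilation repairs. Necessity starts from a common consequence
    of (i) and (ii): every Beurling datum has a preimage in the Roumieu class. The obstacle is that
    the constants [A] and [h] of the preimage are known only after the datum is fixed, and that the
    datum must be smaller than every geometric rate. Hence one datum carries infinitely many
    isolated coefficients, (1/(i+1))^(2j) M_(2j) for the i-th index j, and there (iv) fails by the
    factor (i+1)^3: two powers pay for the smallness of the coefficient, the third outgrows any
    constants. The order 2j leaves room below: M_(2j) >= M_j (mu_j)^j lets the Taylor monomial at
    order j be compared with M_j. *)

Fixpoint psum (f : nat -> R) (n : nat) : R :=
  match n with O => 0 | S k => psum f k + f k end.

Fixpoint pprod (f : nat -> R) (n : nat) : R :=
  match n with O => 1 | S k => pprod f k * f k end.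

Lemma psum_le f g n : (forall k, (k < n)%nat -> f k <= g k) -> psum f n <= psum g n.
Proof.
induction n as [|n IH]; intros H; simpl; [lra|].
apply Rplus_le_compat; [apply IH; intros; apply H; lia | apply H; lia].
Qed.

Lemma psum_ext f g n : (forall k, (k < n)%nat -> f k = g k) -> psum f n = psum g n.
Proof.
induction n as [|n IH]; intros H; simpl; [lra|].
rewrite IH, H; [reflexivity | lia | intros; apply H; lia].
Qed.

Lemma psum_const c n : psum (fun _ => c) n = INR n * c.
Proof. induction n as [|n IH]; [simpl; lra|]. rewrite S_INR; simpl; rewrite IH; lra. Qed.

Lemma psum_scal c f n : psum (fun k => c * f k) n = c * psum f n.
Proof. induction n as [|n IH]; simpl; [lra|]. rewrite IH; lra. Qed.

Lemma psum_add f n m : psum f (n + m) = psum f n + psum (fun k => f (n + k)%nat) m.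
Proof.
induction m as [|m IH]; simpl; [rewrite Nat.add_0_r; lra|].
rewrite Nat.add_succ_r; simpl; rewrite IH; lra.
Qed.

Lemma psum_S_l f n : psum f (S n) = f O + psum (fun k => f (S k)) n.
Proof. change (S n) with (1 + n)%nat; rewrite psum_add; simpl; lra. Qed.

Lemma psum_nonneg f n : (forall k, 0 <= f k) -> 0 <= psum f n.
Proof.
intros H; induction n as [|n IH]; simpl; [lra|]. specialize (H n); lra.
Qed.

Lemma psum_mono f n m : (forall k, 0 <= f k) -> (n <= m)%nat -> psum f n <= psum f m.
Proof.
intros H Hn; replace m with (n + (m - n))%nat by lia; rewrite psum_add.
pose proof (psum_nonneg (fun k => f (n + k)%nat) (m - n) (fun k => H _)); lra.
Qed.

Lemma sum_n_psum f n : sum_n f n = psum f (S n).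
Proof.
induction n as [|n IH]; [rewrite sum_O; simpl; lra|].
rewrite sum_Sn, IH; reflexivity.
Qed.

Lemma is_series_psum f l : is_series f l <-> is_lim_seq (psum f) l.
Proof.
assert (E : is_series f l <-> is_lim_seq (sum_n f) l) by (split; intros H; exact H).
rewrite E; split; intros H.
- apply is_lim_seq_incr_1; eapply is_lim_seq_ext; [|exact H].
  intros n; apply sum_n_psum.
- apply is_lim_seq_incr_1 in H; eapply is_lim_seq_ext; [|exact H].
  intros n; symmetry; apply sum_n_psum.
Qed.

Lemma psum_le_Series f n : (forall k, 0 <= f k) -> ex_series f -> psum f n <= Series f.
Proof.
intros H Hs; apply Series_correct, is_series_psum in Hs.
apply (is_lim_seq_incr_compare _ _ Hs).
intros k; simpl; specialize (H k); lra.
Qed.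

Lemma series_of_bounded f B : (forall k, 0 <= f k) -> (forall n, psum f n <= B) ->
  ex_series f /\ Series f <= B.
Proof.
intros H HB.
assert (E : ex_finite_lim_seq (psum f)).
{ apply (ex_finite_lim_seq_incr _ B); [|exact HB].
  intros k; simpl; specialize (H k); lra. }
destruct E as [l Hl]; assert (Hs : is_series f l) by now apply is_series_psum.
split; [now exists l|].
rewrite (is_series_unique _ _ Hs).
apply (is_lim_seq_le _ _ (Finite l) (Finite B) HB Hl (is_lim_seq_const B)).
Qed.

Lemma pprod_pos f n : (forall k, 0 < f k) -> 0 < pprod f n.
Proof.
intros H; induction n as [|n IH]; simpl; [lra|]. apply Rmult_lt_0_compat; auto.
Qed.

Lemma pprod_le f g n : (forall k, (k < n)%nat -> 0 <= f k <= g k) -> 0 <= pprod f n <= pprod g n.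
Proof.
induction n as [|n IH]; intros H; simpl; [lra|].
destruct IH as [H1 H2]; [intros; apply H; lia|].
destruct (H n) as [H3 H4]; [lia|]. split; [now apply Rmult_le_pos|].
now apply Rmult_le_compat.
Qed.

Lemma pprod_const c n : pprod (fun _ => c) n = c ^ n.
Proof. induction n as [|n IH]; simpl; [reflexivity|]. rewrite IH; ring. Qed.

Lemma pprod_ext f g n : (forall k, (k < n)%nat -> f k = g k) -> pprod f n = pprod g n.
Proof.
induction n as [|n IH]; intros H; simpl; [reflexivity|].
rewrite IH, H; [reflexivity | lia | intros; apply H; lia].
Qed.

Lemma pprod_scal c f n : pprod (fun k => c * f k) n = c ^ n * pprod f n.
Proof. induction n as [|n IH]; simpl; [ring|]. rewrite IH; ring. Qed.

Lemma pprod_S_l f n : pprod f (S n) = f O * pprod (fun k => f (S k)) n.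
Proof.
induction n as [|n IH]; [simpl; ring|].
change (pprod f (S (S n))) with (pprod f (S n) * f (S n)); rewrite IH; simpl; ring.
Qed.

Lemma pprod_add f n m : pprod f (n + m) = pprod f n * pprod (fun k => f (n + k)%nat) m.
Proof.
induction m as [|m IH]; simpl; [rewrite Nat.add_0_r; lra|].
rewrite Nat.add_succ_r; simpl; rewrite IH; ring.
Qed.

(** Increments dominated by the summable [e] make each level uniformly Cauchy, and uniform
    convergence of the derivatives carries the relation to the limit. Level [i] is constrained only
    for large [N], since [N] averages of a continuous function can be differentiated only [N]
    times. *)
Lemma limit_family (f : nat -> nat -> R -> R) (c e : nat -> R) :
  (forall n, 0 <= e n) -> ex_series e -> (forall i, 0 <= c i) ->
  (forall i N x, (i < N)%nat -> is_derive (f N i) x (f N (S i) x)) ->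
  (forall i N x, (i <= N)%nat -> Rabs (f (S N) i x - f N i x) <= c i * e N) ->
  exists F, (forall i x, is_derive (F i) x (F (S i) x)) /\
    forall i x, is_lim_seq (fun N => f N i x) (Finite (F i x : R)).
Proof.
intros He Hs Hc0 Hd Hc.
assert (Hinc : forall i N k x, (i <= N)%nat ->
  Rabs (f (N + k)%nat i x - f N i x) <= c i * (psum e (N + k) - psum e N)).
{ intros i N k x Hi; induction k as [|k IH].
  - rewrite Nat.add_0_r, !Rminus_diag, Rabs_R0; lra.
  - rewrite Nat.add_succ_r; simpl psum.
    replace (f (S (N + k)) i x - f N i x) with
      ((f (S (N + k)) i x - f (N + k)%nat i x) + (f (N + k)%nat i x - f N i x)) by ring.
    eapply Rle_trans; [apply Rabs_triang|].
    specialize (Hc i (N + k)%nat x ltac:(lia)); lra. }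
assert (Hinc' : forall i N k x, (i <= N)%nat ->
  Rabs (f (N + k)%nat i x - f N i x) <= c i * (Series e - psum e N)).
{ intros i N k x Hi; eapply Rle_trans; [apply Hinc, Hi|].
  apply Rmult_le_compat_l; [apply Hc0|].
  pose proof (psum_le_Series e (N + k) He Hs); lra. }
assert (Htail : forall i (eps : posreal), exists N0, (i <= N0)%nat /\
  forall N, (N0 <= N)%nat -> c i * (Series e - psum e N) < eps).
{ intros i eps.
  assert (Hl := proj1 (is_series_psum _ _) (Series_correct _ Hs)).
  assert (Hp : 0 < eps / (c i + 1)).
  { apply Rdiv_lt_0_compat; [apply eps | specialize (Hc0 i); lra]. }
  destruct (proj2 (is_lim_seq_spec _ _) Hl (mkposreal _ Hp)) as [N0 HN0].
  exists (Nat.max i N0); split; [lia|]; intros N HN.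
  specialize (HN0 N ltac:(lia)); simpl in HN0; apply Rabs_def2 in HN0.
  apply Rle_lt_trans with ((c i + 1) * (Series e - psum e N)).
  - pose proof (psum_le_Series e N He Hs); nra.
  - replace (pos eps) with ((c i + 1) * (eps / (c i + 1))).
    + apply Rmult_lt_compat_l; [specialize (Hc0 i)|]; lra.
    + field; specialize (Hc0 i); lra. }
assert (Hex : forall i x, ex_finite_lim_seq (fun N => f N i x)).
{ intros i x; apply ex_lim_seq_cauchy_corr; intros eps.
  destruct (Htail i (pos_div_2 eps)) as [N0 [Hi HN0]]; exists N0; intros n m Hn Hm.
  specialize (HN0 N0 (le_n _)); simpl in HN0.
  assert (B : forall p, (N0 <= p)%nat -> Rabs (f p i x - f N0 i x) < eps / 2).
  { intros p Hp; replace p with (N0 + (p - N0))%nat by lia.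
    eapply Rle_lt_trans; [now apply Hinc'|]; exact HN0. }
  pose proof (B n Hn) as Bn; pose proof (B m Hm) as Bm.
  apply Rabs_def2 in Bn; apply Rabs_def2 in Bm; apply Rabs_def1; lra. }
set (F := fun i x => real (Lim_seq (fun N => f N i x))).
assert (HF : forall i x, is_lim_seq (fun N => f N i x) (Finite (F i x))).
{ intros i x; apply Lim_seq_correct', Hex. }
assert (Hunif : forall i N x, (i <= N)%nat ->
  Rabs (F i x - f N i x) <= c i * (Series e - psum e N)).
{ intros i N x Hi.
  assert (L : is_lim_seq (fun k => Rabs (f (k + N)%nat i x - f N i x))
      (Finite (Rabs (F i x - f N i x)))).
  { apply (is_lim_seq_abs _ (Finite _)), is_lim_seq_minus'; [|apply is_lim_seq_const].
    apply (is_lim_seq_incr_n (fun k => f k i x)), HF. }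
  refine (is_lim_seq_le _ _ (Finite _) (Finite _) _ L (is_lim_seq_const _)).
  intros k; rewrite Nat.add_comm; now apply Hinc'. }
assert (Hcvu : forall i x (r : posreal),
  CVU (fun n => f (n + i + 1)%nat i) (F i) x r).
{ intros i x r eps Heps.
  destruct (Htail i (mkposreal _ Heps)) as [N0 [Hi HN0]]; exists N0; intros n y Hn _.
  eapply Rle_lt_trans; [apply Hunif; lia|]; apply HN0; lia. }
exists F; split; [|exact HF].
intros i x; apply is_derive_Reals.
(* The shift is the one of [Hcvu (S i)] and keeps the index above [i], where the derivative relation
   is available. *)
apply (CVU_derivable (fun n => f (n + S i + 1)%nat i) (fun n => f (n + S i + 1)%nat (S i))
  (F i) (F (S i)) x (mkposreal 1 Rlt_0_1)).
- apply Hcvu.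
- intros y _; apply is_lim_seq_Reals.
  apply (is_lim_seq_ext (fun n => f (n + (S i + 1))%nat i y));
    [intros n; now rewrite Nat.add_assoc|].
  apply (is_lim_seq_incr_n (fun k => f k i y)), HF.
- intros n y _; apply is_derive_Reals, Hd; lia.
- unfold Boule; simpl; rewrite Rminus_diag, Rabs_R0; lra.
Qed.

(** * Cutoff functions from iterated averages *)

Definition sdiff (a : R) (f : R -> R) (x : R) : R := (f (x + a) - f (x - a)) / (2 * a).

(** The mean of [f] over [x - a, x + a], a convolution with a normalized indicator. As a difference
    quotient of a primitive, it has derivative [sdiff a f]. *)
Definition average (a : R) (f : R -> R) : R -> R := sdiff a (fun y => RInt f 0 y).

Lemma is_derive_shift (f : R -> R) a x l :
  is_derive f (x + a) l -> is_derive (fun y => f (y + a)) x l.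
Proof.
intros H; replace l with (scal 1 l) by (unfold scal; simpl; unfold mult; simpl; ring).
apply (is_derive_comp f (fun y => y + a) x l 1 H).
auto_derive; [exact I | reflexivity].
Qed.

Lemma is_derive_sdiff (a : R) (f df : R -> R) :
  (forall x, is_derive f x (df x)) -> forall x, is_derive (sdiff a f) x (sdiff a df x).
Proof.
intros H x; unfold sdiff.
apply (is_derive_ext (fun x => / (2 * a) * (f (x + a) - f (x + - a)))).
{ intros t; apply (Rmult_comm (/ (2 * a))). }
replace ((df (x + a) - df (x - a)) / (2 * a))
  with (/ (2 * a) * (df (x + a) - df (x + - a))) by (unfold Rdiv, Rminus; ring).
apply (is_derive_scal (fun x => f (x + a) - f (x + - a))).
apply (is_derive_minus (fun x => f (x + a)) (fun x => f (x + - a)));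
  now apply is_derive_shift.
Qed.

Lemma is_derive_primitive (f : R -> R) :
  (forall x, continuous f x) -> forall x, is_derive (fun y => RInt f 0 y) x (f x).
Proof.
intros H x; apply (is_derive_RInt f _ 0); [|apply H].
exists (mkposreal 1 Rlt_0_1); intros y _; apply (RInt_correct f).
apply (ex_RInt_continuous (V := R_CompleteNormedModule)); intros; apply H.
Qed.

Lemma is_derive_average (a : R) (f : R -> R) : (forall x, continuous f x) ->
  forall x, is_derive (average a f) x (sdiff a f x).
Proof. intros H; apply is_derive_sdiff; now apply is_derive_primitive. Qed.

Lemma is_derive_continuous (f df : R -> R) :
  (forall x, is_derive f x (df x)) -> forall x, continuous f x.
Proof. intros H x; apply (ex_derive_continuous (V := R_NormedModule)); now exists (df x). Qed.

(** The mean value theorem for the difference of two primitives. The common point [c] lets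
    [averages_increment] compare N and N + 1 averages. *)
Lemma average_minus_mean (a : R) (f g : R -> R) (x : R) : 0 < a ->
  (forall y, continuous f y) -> (forall y, continuous g y) ->
  exists c, Rabs (c - x) <= a /\ average a f x - average a g x = f c - g c.
Proof.
intros Ha Hf Hg.
destruct (MVT_gen (fun y => RInt f 0 y - RInt g 0 y) (x - a) (x + a) (fun y => f y - g y))
  as [c [Hc E]].
- intros y _; apply (is_derive_minus (fun y => RInt f 0 y) (fun y => RInt g 0 y));
    now apply is_derive_primitive.
- intros y _; apply derivable_continuous_pt; exists (f y - g y); apply is_derive_Reals.
  apply (is_derive_minus (fun y => RInt f 0 y) (fun y => RInt g 0 y));
    now apply is_derive_primitive.
- rewrite Rmin_left, Rmax_right in Hc by lra.
  exists c; split; [apply Rabs_le; lra|].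
  unfold average, sdiff; replace (f c - g c) with
    ((f c - g c) * (x + a - (x - a)) / (2 * a)) by (field; lra).
  rewrite <- E; field; lra.
Qed.

Lemma average_mean (a : R) (f : R -> R) (x : R) : 0 < a -> (forall y, continuous f y) ->
  exists c, Rabs (c - x) <= a /\ average a f x = f c.
Proof.
intros Ha Hf; destruct (average_minus_mean a f (fun _ => 0) x Ha Hf) as [c [Hc E]].
{ intros y; apply continuous_const. }
exists c; split; [exact Hc|].
assert (E0 : average a (fun _ => 0) x = 0).
{ unfold average, sdiff; rewrite !RInt_const; unfold scal; simpl; unfold mult; simpl; field; lra. }
rewrite E0 in E; lra.
Qed.

Fixpoint averages (a : nat -> R) (N : nat) (f : R -> R) : R -> R :=
  match N with
  | O => f
  | S N' => average (a O) (averages (fun l => a (S l)) N' f)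
  end.

(* The [i]-th derivative of [averages a N f]: each derivative turns one average
   into a difference quotient. *)
Fixpoint averages_derive (a : nat -> R) (N i : nat) (f : R -> R) : R -> R :=
  match i, N with
  | O, _ => averages a N f
  | S i', S N' => sdiff (a O) (averages_derive (fun l => a (S l)) N' i' f)
  | S _, O => fun _ => 0
  end.

Section Bump.

Variable f : R -> R.
Hypothesis Cf : forall x, continuous f x.

Lemma averages_continuous a N x : continuous (averages a N f) x.
Proof.
revert a x; induction N as [|N IH]; intros a x; simpl; [apply Cf|].
now apply (is_derive_continuous _ (sdiff (a O) (averages (fun l => a (S l)) N f))),
  is_derive_average.
Qed.

Lemma is_derive_averages a N i x : (i < N)%nat ->
  is_derive (averages_derive a N i f) x (averages_derive a N (S i) f x).
Proof.
revert a N x; induction i as [|i IH]; intros a [|N] x Hi; try lia.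
- simpl; destruct N; apply is_derive_average; intros; apply averages_continuous.
- change (averages_derive a (S N) (S i) f)
    with (sdiff (a O) (averages_derive (fun l => a (S l)) N i f)).
  change (averages_derive a (S N) (S (S i)) f)
    with (sdiff (a O) (averages_derive (fun l => a (S l)) N (S i) f)).
  revert x; apply is_derive_sdiff; intros x; apply IH; lia.
Qed.

Lemma averages_mean a N x : (forall l, 0 < a l) ->
  exists c, Rabs (c - x) <= psum a N /\ averages a N f x = f c.
Proof.
revert a x; induction N as [|N IH]; intros a x Ha.
- exists x; simpl; rewrite Rminus_diag, Rabs_R0; split; [lra | reflexivity].
- destruct (average_mean (a O) (averages (fun l => a (S l)) N f) x (Ha O)) as [c [Hc E]].
  { intros y; apply averages_continuous. }
  destruct (IH (fun l => a (S l)) c) as [d [Hd E']]; [intros; apply Ha|].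
  exists d; split; [|simpl; now rewrite E].
  rewrite psum_S_l; replace (d - x) with ((d - c) + (c - x)) by ring.
  eapply Rle_trans; [apply Rabs_triang | lra].
Qed.

(** The additional average is the innermost one. It moves a Lipschitz function by at most [L * a N],
    and the outer averages do not increase the sup norm. *)
Lemma averages_increment a N x L : (forall l, 0 < a l) -> 0 <= L ->
  (forall y z, Rabs (f y - f z) <= L * Rabs (y - z)) ->
  Rabs (averages a (S N) f x - averages a N f x) <= L * a N.
Proof.
intros Ha HL Hf; revert a x Ha; induction N as [|N IH]; intros a x Ha.
- simpl; destruct (average_mean (a O) f x (Ha O) Cf) as [c [Hc E]]; rewrite E.
  eapply Rle_trans; [apply Hf|]; now apply Rmult_le_compat_l.
- destruct (average_minus_mean (a O) (averages (fun l => a (S l)) (S N) f)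
    (averages (fun l => a (S l)) N f) x (Ha O)) as [c [Hc E]];
    try (intros; apply averages_continuous).
  change (Rabs (average (a O) (averages (fun l => a (S l)) (S N) f) x
    - average (a O) (averages (fun l => a (S l)) N f) x) <= L * a (S N)).
  rewrite E; apply (IH (fun l => a (S l))); intros; apply Ha.
Qed.

Lemma sdiff_bound a (g : R -> R) x B : 0 < a -> (forall y, Rabs (g y) <= B) ->
  Rabs (sdiff a g x) <= / a * B.
Proof.
intros Ha H; unfold sdiff, Rdiv; rewrite Rabs_mult.
rewrite (Rabs_pos_eq (/ (2 * a))); [|left; apply Rinv_0_lt_compat; lra].
rewrite Rinv_mult; replace (/ a * B) with (2 * B * (/ 2 * / a)) by (field; lra).
apply Rmult_le_compat_r.
{ rewrite <- Rinv_mult; left; apply Rinv_0_lt_compat; lra. }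
unfold Rminus; eapply Rle_trans; [apply Rabs_triang|].
rewrite Rabs_Ropp; pose proof (H (x + a)); pose proof (H (x + - a)); lra.
Qed.

Lemma averages_derive_bound a N i x B : (forall l, 0 < a l) ->
  (forall y, Rabs (f y) <= B) ->
  Rabs (averages_derive a N i f x) <= pprod (fun l => / a l) i * B.
Proof.
intros Ha HB; revert a N x Ha; induction i as [|i IH]; intros a N x Ha.
- replace (averages_derive a N 0 f) with (averages a N f) by (destruct N; reflexivity).
  destruct (averages_mean a N x Ha) as [c [_ ->]]; simpl; specialize (HB c); lra.
- rewrite pprod_S_l, Rmult_assoc; destruct N as [|N].
  + simpl; rewrite Rabs_R0; assert (0 <= B) by (eapply Rle_trans; [apply Rabs_pos | apply (HB 0)]).
    apply Rmult_le_pos; [left; apply Rinv_0_lt_compat, Ha|].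
    apply Rmult_le_pos; [|assumption].
    left; apply pprod_pos; intros k; apply Rinv_0_lt_compat, Ha.
  + apply sdiff_bound; [apply Ha|]; intros y.
    apply (IH (fun l => a (S l))); intros; apply Ha.
Qed.

Lemma averages_derive_increment a N i x L : (forall l, 0 < a l) -> 0 <= L -> (i <= N)%nat ->
  (forall y z, Rabs (f y - f z) <= L * Rabs (y - z)) ->
  Rabs (averages_derive a (S N) i f x - averages_derive a N i f x)
    <= pprod (fun l => / a l) i * (L * a N).
Proof.
intros Ha HL Hi Hf; revert a N x Ha Hi; induction i as [|i IH]; intros a N x Ha Hi.
- replace (averages_derive a N 0 f) with (averages a N f) by (destruct N; reflexivity).
  change (averages_derive a (S N) 0 f) with (averages a (S N) f).
  pose proof (averages_increment a N x L Ha HL Hf); simpl pprod; lra.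
- destruct N as [|N]; [lia|].
  change (averages_derive a (S (S N)) (S i) f)
    with (sdiff (a O) (averages_derive (fun l => a (S l)) (S N) i f)).
  change (averages_derive a (S N) (S i) f)
    with (sdiff (a O) (averages_derive (fun l => a (S l)) N i f)).
  rewrite pprod_S_l, Rmult_assoc.
  replace (sdiff (a O) (averages_derive (fun l => a (S l)) (S N) i f) x
    - sdiff (a O) (averages_derive (fun l => a (S l)) N i f) x)
    with (sdiff (a O) (fun y => averages_derive (fun l => a (S l)) (S N) i f y
      - averages_derive (fun l => a (S l)) N i f y) x)
    by (unfold sdiff, Rdiv; ring).
  apply sdiff_bound; [apply Ha|]; intros y.
  apply (IH (fun l => a (S l))); [intros; apply Ha | lia].
Qed.

End Bump.

(** Equal to 1 for |x| <= 2 S and to 0 for |x| >= 3 S, so averages of total width at most [S] remain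
    1 near 0 and 0 beyond 4 S. *)
Definition trapezoid (S x : R) : R := Rmax 0 (Rmin 1 (3 - Rabs x / S)).

Lemma trapezoid_bound S x : Rabs (trapezoid S x) <= 1.
Proof.
unfold trapezoid, Rmax, Rmin; repeat destruct Rle_dec; apply Rabs_le; lra.
Qed.

Lemma trapezoid_lipschitz S y z : 0 < S ->
  Rabs (trapezoid S y - trapezoid S z) <= / S * Rabs (y - z).
Proof.
intros HS.
assert (E : Rabs (Rabs y / S - Rabs z / S) <= / S * Rabs (y - z)).
{ replace (Rabs y / S - Rabs z / S) with (/ S * (Rabs y - Rabs z)) by (field; lra).
  rewrite Rabs_mult, (Rabs_pos_eq (/ S)) by (left; now apply Rinv_0_lt_compat).
  apply Rmult_le_compat_l; [left; now apply Rinv_0_lt_compat|].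
  apply Rabs_triang_inv2. }
eapply Rle_trans; [|exact E].
unfold trapezoid; set (u := Rabs y / S); set (v := Rabs z / S).
unfold Rmax, Rmin, Rabs; repeat destruct Rle_dec; repeat destruct Rcase_abs; lra.
Qed.

Lemma trapezoid_in S x : 0 < S -> Rabs x <= 2 * S -> trapezoid S x = 1.
Proof.
intros HS H; unfold trapezoid.
assert (Rabs x / S <= 2) by (apply Rle_div_l; lra).
rewrite Rmin_left by lra; apply Rmax_right; lra.
Qed.

Lemma trapezoid_out S x : 0 < S -> 3 * S <= Rabs x -> trapezoid S x = 0.
Proof.
intros HS H; unfold trapezoid.
assert (3 <= Rabs x / S) by (apply Rle_div_r; lra).
apply Rmax_left; apply Rle_trans with (3 - Rabs x / S); [apply Rmin_r | lra].
Qed.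

Lemma lipschitz_continuous (f : R -> R) L : 0 < L ->
  (forall y z, Rabs (f y - f z) <= L * Rabs (y - z)) -> forall x, continuous f x.
Proof.
intros HL H x; apply continuity_pt_filterlim.
intros eps Heps; exists (eps / L); split; [now apply Rdiv_lt_0_compat|].
intros y [_ Hy]; simpl in *; unfold Rdist in *.
eapply Rle_lt_trans; [apply H|].
replace eps with (L * (eps / L)) by (field; lra); now apply Rmult_lt_compat_l.
Qed.

Lemma derivatives_locally_constant (F : nat -> R -> R) (U : R -> Prop) c : open U ->
  (forall i x, is_derive (F i) x (F (S i) x)) -> (forall x, U x -> F O x = c) ->
  forall i x, U x -> F (S i) x = 0.
Proof.
intros HU HF H0 i; induction i as [|i IH]; intros x Hx;
  rewrite <- (is_derive_unique _ _ _ (HF _ x)).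
- rewrite (Derive_ext_loc _ (fun _ => c)); [apply Derive_const|].
  now apply (filter_imp U); [exact H0 | apply HU].
- rewrite (Derive_ext_loc _ (fun _ => 0)); [apply Derive_const|].
  now apply (filter_imp U); [exact IH | apply HU].
Qed.

(** The infinite convolution familiar from the Denjoy-Carleman theorem. In the derivative of order
    [i], the first [i] averages become difference quotients and cost [/ a 0], ..., [/ a (i - 1)];
    the others do not increase the sup norm. *)
Lemma bump (a : nat -> R) (S : R) : (forall l, 0 < a l) -> 0 < S ->
  (forall N, psum a N <= S) ->
  exists phi, (forall i x, is_derive (phi i) x (phi (Datatypes.S i) x)) /\
    (forall i x, Rabs (phi i x) <= pprod (fun l => / a l) i) /\
    phi O 0 = 1 /\ (forall i, phi (Datatypes.S i) 0 = 0) /\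
    (forall i x, 4 * S < Rabs x -> phi i x = 0).
Proof.
intros Ha HS Hsum.
assert (Ha' : forall l, 0 <= a l) by (intros l; left; apply Ha).
assert (HL : 0 < / S) by now apply Rinv_0_lt_compat.
assert (Lip := fun y z => trapezoid_lipschitz S y z HS).
assert (Cf := lipschitz_continuous _ _ HL Lip).
assert (Hpp : forall i, 0 < pprod (fun l => / a l) i).
{ intros i; apply pprod_pos; intros k; apply Rinv_0_lt_compat, Ha. }
destruct (limit_family (fun N i => averages_derive a N i (trapezoid S))
  (fun i => pprod (fun l => / a l) i * / S) a) as [phi [Hd Hl]].
- exact Ha'.
- now apply (series_of_bounded a S).
- intros i; left; apply Rmult_lt_0_compat; [apply Hpp | exact HL].
- intros i N x Hi; now apply is_derive_averages.
- intros i N x Hi; rewrite Rmult_assoc.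
  apply averages_derive_increment; auto; lra.
(* Every finite average at [x] is a value of the trapezoid within [S] of [x], so constancy of the
   trapezoid there passes to the limit. *)
- assert (H0 : forall c (V : R -> Prop), (forall x y, V x -> Rabs (y - x) <= S -> trapezoid S y = c) ->
    forall x, V x -> phi O x = c).
  { intros c V HV x Hx; specialize (Hl O x).
    apply is_lim_seq_unique in Hl; rewrite (Lim_seq_ext _ (fun _ => c)) in Hl.
    - rewrite Lim_seq_const in Hl; now injection Hl.
    - intros N; destruct (averages_mean (trapezoid S) Cf a N x Ha) as [y [Hy E]].
      replace (averages_derive a N 0 (trapezoid S) x) with (averages a N (trapezoid S) x)
        by (destruct N; reflexivity).
      rewrite E; apply (HV x); [exact Hx|]; specialize (Hsum N); lra. }
  assert (Hin : forall x, Rabs x < S -> phi O x = 1).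
  { apply H0; intros x y Hx Hy; apply trapezoid_in; [exact HS|].
    replace y with ((y - x) + x) by ring.
    eapply Rle_trans; [apply Rabs_triang | lra]. }
  assert (Hout : forall x, 4 * S < Rabs x -> phi O x = 0).
  { apply H0; intros x y Hx Hy; apply trapezoid_out; [exact HS|].
    pose proof (Rabs_triang (x - y) y) as T; replace (x - y + y) with x in T by ring.
    rewrite Rabs_minus_sym in T; lra. }
  exists phi; split; [exact Hd|]; split; [|split; [|split]].
  + intros i x; apply (is_lim_seq_le (fun N => Rabs (averages_derive a N i (trapezoid S) x))
      (fun _ => pprod (fun l => / a l) i) (Finite _) (Finite _)).
    * intros N; rewrite <- (Rmult_1_r (pprod _ i)).
      apply averages_derive_bound; auto; apply trapezoid_bound.
    * apply (is_lim_seq_abs _ (Finite _)), Hl.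
    * apply is_lim_seq_const.
  + apply Hin; rewrite Rabs_R0; exact HS.
  + intros i; apply (derivatives_locally_constant phi (fun x => Rabs x < S) 1); auto.
    * apply (open_comp Rabs (fun u => u < S)); [|apply open_lt].
      intros x _; apply (continuous_Rabs x).
    * rewrite Rabs_R0; exact HS.
  + intros [|i] x Hx; [now apply Hout|].
    apply (derivatives_locally_constant phi (fun x => 4 * S < Rabs x) 0); auto.
    apply (open_comp Rabs (fun u => 4 * S < u)); [|apply open_gt].
    intros y _; apply (continuous_Rabs y).
Qed.

(** * Extension with bounds *)

Lemma epsilon_choice (X Y : Type) (P : X -> Y -> Prop) :
  (forall x, exists y, P x y) -> exists f, forall x, P x (f x).
Proof.
intros H; exists (fun x => proj1_sig (constructive_indefinite_description _ (H x))).
intros x; apply proj2_sig.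
Qed.

Definition monomial (d : nat) (x : R) : R := x ^ d / INR (fact d).

Lemma is_derive_monomial d x : is_derive (monomial (S d)) x (monomial d x).
Proof.
unfold monomial.
assert (E : INR (fact (S d)) = INR (S d) * INR (fact d)) by (rewrite fact_simpl; apply mult_INR).
pose proof (INR_fact_neq_0 d); pose proof (not_0_INR (S d) ltac:(lia)).
rewrite E; set (c := INR (S d)) in *; set (k := INR (fact d)) in *.
apply (is_derive_ext (fun y => / (c * k) * y ^ S d)); [intros y; apply Rmult_comm|].
replace (x ^ d / k) with (/ (c * k) * (c * 1 * x ^ d)) by (field; split; assumption).
apply is_derive_scal, (is_derive_pow (fun y => y) (S d) x 1).
apply (is_derive_id (K := R_AbsRing)).
Qed.

Lemma exp_nat (n : nat) x : exp (INR n * x) = exp x ^ n.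
Proof.
induction n as [|n IH]; [simpl; now rewrite Rmult_0_l, exp_0|].
rewrite S_INR, Rmult_plus_distr_r, exp_plus, IH, Rmult_1_l; simpl; ring.
Qed.

Lemma monomial_le_exp d y : 0 <= y -> monomial d y <= exp y.
Proof.
intros Hy; eapply Rle_trans; [|apply (exp_ge_taylor y d Hy)].
assert (P : forall k, 0 <= y ^ k / INR (fact k)).
{ intros k; apply Rle_mult_inv_pos; [now apply pow_le | apply INR_fact_lt_0]. }
unfold monomial; destruct d as [|d]; [simpl; lra|].
rewrite tech5; pose proof (cond_pos_sum _ d P); lra.
Qed.

(* [leibniz phi i d j] is the [i]-th derivative of [monomial d * phi j]. *)
Fixpoint leibniz (phi : nat -> R -> R) (i d j : nat) (x : R) : R :=
  match i, d with
  | O, _ => monomial d x * phi j x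
  | S i', O => leibniz phi i' O (S j) x
  | S i', S d' => leibniz phi i' d' j x + leibniz phi i' d (S j) x
  end.

Lemma is_derive_leibniz (phi : nat -> R -> R) i d j (x : R) : (forall i x, is_derive (phi i) x (phi (S i) x)) ->
  is_derive (leibniz phi i d j) x (leibniz phi (S i) d j x).
Proof.
intros Hphi; revert d j x; induction i as [|i IH]; intros d j x.
- destruct d as [|d].
  + assert (E : forall t, phi j t = leibniz phi 0 0 j t)
      by (intros t; unfold leibniz, monomial; simpl; field).
    apply (is_derive_ext _ _ _ _ E).
    assert (E1 : leibniz phi 1 0 j x = phi (S j) x)
      by (unfold leibniz, monomial; simpl; field).
    rewrite E1; apply Hphi.
  + apply (is_derive_mult (monomial (S d)) (phi j) x (monomial d x) (phi (S j) x));
      [apply is_derive_monomial | apply Hphi | intros; apply Rmult_comm].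
- destruct d as [|d]; [apply IH|].
  change (leibniz phi (S (S i)) (S d) j x) with
    (leibniz phi (S i) d j x + leibniz phi (S i) (S d) (S j) x).
  apply (is_derive_plus (leibniz phi i d j) (leibniz phi i (S d) (S j))); apply IH.
Qed.

Lemma leibniz_vanish phi i d j x : (forall j, phi j x = 0) -> leibniz phi i d j x = 0.
Proof.
intros H; revert d j; induction i as [|i IH]; intros [|d] j; simpl;
  rewrite ?IH, ?H; ring.
Qed.

Lemma leibniz_zero phi i d j : phi O 0 = 1 -> (forall j, phi (S j) 0 = 0) ->
  leibniz phi i d j 0 = if andb (Nat.eqb i d) (Nat.eqb j 0) then 1 else 0.
Proof.
intros H0 H1; revert d j; induction i as [|i IH]; intros [|d] j; simpl.
- destruct j; unfold monomial; simpl; rewrite ?H0, ?H1; field.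
- unfold monomial; simpl; unfold Rdiv; rewrite !Rmult_0_l; reflexivity.
- rewrite IH; now rewrite Bool.andb_false_r.
- rewrite !IH; simpl; rewrite Bool.andb_false_r; ring.
Qed.

(** A Leibniz step replaces a term by two: one loses a degree, the other differentiates [phi] once
    more. Losing a degree costs a factor [mq], which the growth of [U] covers. Both terms thus obey
    one bound, and only [2 ^ i] is lost. *)
Lemma leibniz_bound phi U (mq E x : R) : 0 < mq -> 0 <= E ->
  (forall j, 0 <= U j) -> (forall j, mq * U j <= U (S j)) ->
  (forall j, Rabs (phi j x) <= U j) -> (forall d, Rabs (monomial d x) <= E * (/ mq) ^ d) ->
  forall i d j, Rabs (leibniz phi i d j x) <= 2 ^ i * (E * (/ mq) ^ d * U (i + j)%nat).
Proof.
intros Hm HE HU HmU Hphi Hmon i; induction i as [|i IH]; intros d j.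
- simpl; replace (match d with O => _ | _ => _ end) with (monomial d x * phi j x)
    by (destruct d; reflexivity).
  rewrite Rabs_mult, Rmult_1_l; apply Rmult_le_compat; auto using Rabs_pos.
- assert (Hi : forall d, 0 <= (/ mq) ^ d) by (intros; apply pow_le; left; now apply Rinv_0_lt_compat).
  assert (H2 : 0 < 2 ^ i) by (apply pow_lt; lra).
  assert (HX : forall d j, 0 <= E * (/ mq) ^ d * U j).
  { intros; repeat apply Rmult_le_pos; auto. }
  destruct d as [|d]; simpl leibniz.
  + eapply Rle_trans; [apply IH|]; rewrite Nat.add_succ_r; simpl (2 ^ S i).
    change (S i + j)%nat with (S (i + j)).
    specialize (HX O (S (i + j))); nra.
  + eapply Rle_trans; [apply Rabs_triang|].
    pose proof (IH d j) as I1; pose proof (IH (S d) (S j)) as I2.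
    rewrite Nat.add_succ_r in I2; change (S i + j)%nat with (S (i + j)).
    assert (K : E * (/ mq) ^ d * U (i + j)%nat <= E * (/ mq) ^ S d * U (S (i + j))).
    { replace (E * (/ mq) ^ d * U (i + j)%nat) with
        (E * (/ mq) ^ S d * (mq * U (i + j)%nat)) by (simpl; field; lra).
      apply Rmult_le_compat_l; [|apply HmU]. apply Rmult_le_pos; auto. }
    simpl (2 ^ S i).
    apply Rmult_le_compat_l with (r := 2 ^ i) in K; [|lra].
    lra.
Qed.

Lemma psum_blocks r g K : (1 <= r)%nat ->
  psum (fun l => g (l / r)%nat) (r * K) = INR r * psum g K.
Proof.
intros Hr; induction K as [|K IH]; [rewrite Nat.mul_0_r; simpl; lra|].
rewrite Nat.mul_succ_r, psum_add, IH; simpl psum.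
rewrite (psum_ext (fun k => g ((r * K + k) / r)%nat) (fun _ => g K)), psum_const; [ring|].
intros k Hk; f_equal; symmetry; apply (Nat.div_unique _ _ _ k); lia.
Qed.

Lemma pprod_blocks r g K : (1 <= r)%nat ->
  pprod (fun l => g (l / r)%nat) (r * K) = pprod g K ^ r.
Proof.
intros Hr; induction K as [|K IH]; [rewrite Nat.mul_0_r; simpl; now rewrite pow1|].
rewrite Nat.mul_succ_r, pprod_add, IH; simpl pprod.
rewrite (pprod_ext (fun k => g ((r * K + k) / r)%nat) (fun _ => g K)), pprod_const; [now rewrite Rpow_mult_distr|].
intros k Hk; f_equal; symmetry; apply (Nat.div_unique _ _ _ k); lia.
Qed.

Lemma psum_single f n N : (forall k, k <> n -> f k = 0) -> (n < N)%nat -> psum f N = f n.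
Proof.
intros H; induction N as [|N IH]; intros HN; [lia|]; simpl.
destruct (Nat.eq_dec n N) as [->|Hne].
- rewrite (psum_ext _ (fun _ => 0)), psum_const; [lra|].
  intros k Hk; apply H; lia.
- rewrite IH, (H N) by lia; lra.
Qed.

Lemma psum_zero f N : (forall k, (k < N)%nat -> f k = 0) -> psum f N = 0.
Proof. intros H; rewrite (psum_ext _ (fun _ => 0)), psum_const by exact H; lra. Qed.

(** Condition (iv) through partial sums, which for positive [m] includes the convergence of the
    series. *)
Definition tail_bound (m : nat -> R) (A : R) : Prop :=
  forall p n, (1 <= p)%nat -> m p * psum (fun k => / m (p + k)%nat) n <= A * INR p.

Section Extension.

Variables (r : nat) (m : nat -> R) (A : R).
Hypothesis Hr : (1 <= r)%nat.
Hypothesis mpos : forall k, 0 < m k.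
Hypothesis mincr : forall k, m k <= m (S k).
Hypothesis Htail : tail_bound m A.

Lemma m_mono j k : (j <= k)%nat -> m j <= m k.
Proof.
induction 1 as [|k _ IH]; [lra|]. specialize (mincr k); lra.
Qed.

Lemma tail_bound_ge1 : 1 <= A.
Proof.
pose proof (Htail 1%nat 1%nat (le_n _)) as H; simpl in H.
rewrite Rplus_0_l, Rinv_r, Rmult_1_r in H; [exact H | apply Rgt_not_eq, mpos].
Qed.

Definition ratio (l : nat) : R := m (S (l / r)).
(** The ratios raised to at least [m q]. The widths [/ ratio l] for small [l] would be too large for
    a cutoff of size [q / m q]. *)
Definition capped (q l : nat) : R := m (Nat.max (S (l / r)) q).

(* [weight (r * k)] is [(m 1 ... m k) ^ r]; the other values interpolate. *)
Definition weight (i : nat) : R := pprod ratio i.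

Lemma weight_pos i : 0 < weight i.
Proof. apply pprod_pos; intros; apply mpos. Qed.

Lemma weight_mul k : weight (r * k) = pprod (fun l => m (S l)) k ^ r.
Proof. apply (pprod_blocks r (fun l => m (S l))), Hr. Qed.

(** Each width occurs in a block of [r]. The first [q] blocks account for [q / m q], the later ones
    for at most [A * q / m q] by the tail bound at [q]. *)
Lemma widths_sum q N : (1 <= q)%nat ->
  psum (fun l => / capped q l) N <= INR r * (1 + A) * INR q / m q.
Proof.
intros Hq.
assert (Hpos : forall l, 0 <= / capped q l).
{ intros l; left; apply Rinv_0_lt_compat, mpos. }
assert (H1 : psum (fun k => / m (Nat.max (S k) q)) N <= (1 + A) * INR q / m q).
{ eapply Rle_trans; [apply (psum_mono _ N (q + N))|].
  - intros k; left; apply Rinv_0_lt_compat, mpos.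
  - lia.
  - rewrite psum_add.
    replace ((1 + A) * INR q / m q) with (INR q * / m q + A * INR q / m q)
      by (field; apply Rgt_not_eq, mpos).
    apply Rplus_le_compat.
    + rewrite <- psum_const; apply psum_le; intros k Hk.
      replace (Nat.max (S k) q) with q by lia; lra.
    + apply Rle_div_r; [apply mpos|]; rewrite Rmult_comm.
      eapply Rle_trans; [|apply (Htail q N Hq)].
      apply Rmult_le_compat_l; [left; apply mpos|].
      apply psum_le; intros k Hk; apply Rinv_le_contravar; [apply mpos|].
      apply m_mono; lia. }
eapply Rle_trans; [apply (psum_mono _ N (r * N)); [exact Hpos | nia]|].
unfold capped; rewrite (psum_blocks r (fun k => / m (Nat.max (S k) q))) by exact Hr.
replace (INR r * (1 + A) * INR q / m q) with (INR r * ((1 + A) * INR q / m q))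
  by (unfold Rdiv; ring).
apply Rmult_le_compat_l; [apply pos_INR | exact H1].
Qed.

(** Equality for [i >= r * n]: the first [r * n] capped factors are [m q], the others are ratios.
    Below that, lowering [i] removes [capped q l] on the left and the smaller [ratio l] on the
    right. The maximum with 1 is there because the tail bound starts at index 1. *)
Lemma capped_weight n i (q := Nat.max n 1) :
  pprod (capped q) i * weight (r * n) <= weight i * m q ^ (r * n).
Proof.
assert (Hpp : forall i, 0 < pprod (capped q) i) by (intros; apply pprod_pos; intros; apply mpos).
assert (Hw := weight_pos).
assert (Hmq : 0 < m q ^ (r * n)) by apply pow_lt, mpos.
assert (Hlow : forall l, (l < r * n)%nat -> capped q l = m q).
{ intros l Hl; unfold capped; f_equal.
  assert (l / r < n)%nat by (apply Nat.Div0.div_lt_upper_bound; lia). lia. }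
assert (Hhigh : forall l, (r * n <= l)%nat -> capped q l = ratio l).
{ intros l Hl; unfold capped, ratio; f_equal.
  assert (n <= l / r)%nat by (apply Nat.div_le_lower_bound; lia). lia. }
assert (Heq : pprod (capped q) (r * n) = m q ^ (r * n)).
{ rewrite <- pprod_const; apply pprod_ext; exact Hlow. }
destruct (Nat.le_gt_cases (r * n) i) as [Hi|Hi].
- induction Hi as [|i Hi IH]; [rewrite Heq; lra|].
  unfold weight in *; simpl; rewrite (Hhigh i Hi).
  assert (0 < ratio i) by apply mpos.
  apply Rmult_le_compat_l with (r := ratio i) in IH; [|lra]; lra.
- replace i with (r * n - (r * n - i))%nat by lia.
  set (t := (r * n - i)%nat); assert (Ht : (t <= r * n)%nat) by (unfold t; lia).
  clearbody t; clear Hi; induction t as [|t IH].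
  + rewrite Nat.sub_0_r, Heq; lra.
  + specialize (IH ltac:(lia)).
    set (l := (r * n - S t)%nat) in *; replace (r * n - t)%nat with (S l) in IH by lia.
    unfold weight in IH; simpl in IH; fold (weight l) (weight (r * n)) in IH.
    assert (Hl : ratio l <= capped q l) by (apply m_mono; lia).
    assert (0 < ratio l) by apply mpos.
    apply Rmult_le_reg_l with (capped q l); [apply mpos|].
    apply Rle_trans with (weight l * ratio l * m q ^ (r * n)); [lra|].
    specialize (Hw l).
    assert (0 < weight l * m q ^ (r * n)) by now apply Rmult_lt_0_compat.
    nra.
Qed.

(** On the support, |x| <= kappa q / m q, so x^d / d! is at most exp (kappa q) / (m q)^d. The power
    of [m q] is traded for [weight (r * n)] by [capped_weight]. The exponent in [K ^ S n] comes from
    q = max n 1 <= n + 1. *)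
Lemma cutoff_monomials : exists K R0, 1 <= K /\ 0 < R0 /\ forall n,
  exists chi : nat -> R -> R, (forall i x, is_derive (chi i) x (chi (S i) x)) /\
    (forall i x, Rabs (chi i x) <= 2 ^ i * (K ^ S n * (weight i / weight (r * n)))) /\
    (forall i, chi i 0 = if Nat.eqb i (r * n) then 1 else 0) /\
    (forall i x, R0 < Rabs x -> chi i x = 0).
Proof.
pose proof tail_bound_ge1 as HA.
assert (Hr1 : 1 <= INR r) by (apply (le_INR 1); exact Hr).
set (kappa := 4 * (INR r * (1 + A))).
assert (Hk : 0 < kappa) by (unfold kappa; nra).
(* The support radius 4 * S0 is kappa q / m q. The tail bound at 1 gives q / m q <= A / m 1, hence a
   radius independent of [n]. *)
exists (exp kappa), (kappa * A / m 1%nat).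
assert (HK : 1 <= exp kappa) by (rewrite <- exp_0; left; now apply exp_increasing).
split; [exact HK|]; split.
{ apply Rdiv_lt_0_compat; [nra | apply mpos]. }
intros n; set (q := Nat.max n 1); set (S0 := INR r * (1 + A) * INR q / m q).
assert (Hq : (1 <= q)%nat) by (unfold q; lia).
assert (Hq1 : 1 <= INR q) by (apply (le_INR 1); exact Hq).
assert (Hmq : 0 < m q) by apply mpos.
assert (HS0 : 0 < S0).
{ apply Rdiv_lt_0_compat; [|exact Hmq]; apply Rmult_lt_0_compat; nra. }
assert (E4 : 4 * S0 = kappa * INR q * / m q) by (unfold S0, kappa; field; lra).
destruct (bump (fun l => / capped q l) S0) as [phi [Hd [Hb [H0 [H1 Hout]]]]].
- intros l; apply Rinv_0_lt_compat, mpos.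
- exact HS0.
- intros N; now apply widths_sum.
- exists (fun i => leibniz phi i (r * n) 0); split; [|split; [|split]].
  + intros i x; now apply is_derive_leibniz.
  + intros i x.
    assert (HU : forall j, 0 < pprod (capped q) j) by (intros; apply pprod_pos; intros; apply mpos).
    apply Rle_trans with (2 ^ i * (exp kappa ^ S n * (/ m q) ^ (r * n) * pprod (capped q) (i + 0))).
    * destruct (Rle_lt_dec (Rabs x) (4 * S0)) as [Hx|Hx].
      -- apply leibniz_bound.
         ++ exact Hmq.
         ++ apply pow_le; lra.
         ++ intros; left; apply HU.
         ++ intros j; simpl; rewrite Rmult_comm; apply Rmult_le_compat_l; [left; apply HU|].
            apply m_mono; lia.
         ++ intros j; eapply Rle_trans; [apply Hb|].
            rewrite (pprod_ext _ (capped q)); [lra|]; intros; apply Rinv_inv.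
         ++ intros d; unfold monomial, Rdiv; rewrite Rabs_mult, <- RPow_abs.
            rewrite (Rabs_pos_eq (/ _)) by (left; apply Rinv_0_lt_compat, INR_fact_lt_0).
            apply Rle_trans with ((kappa * INR q * / m q) ^ d * / INR (fact d)).
            { apply Rmult_le_compat_r; [left; apply Rinv_0_lt_compat, INR_fact_lt_0|].
              apply pow_incr; split; [apply Rabs_pos | lra]. }
            rewrite Rpow_mult_distr.
            replace ((kappa * INR q) ^ d * (/ m q) ^ d * / INR (fact d))
              with (monomial d (kappa * INR q) * (/ m q) ^ d) by (unfold monomial, Rdiv; ring).
            apply Rmult_le_compat_r; [apply pow_le; left; now apply Rinv_0_lt_compat|].
            eapply Rle_trans; [apply monomial_le_exp; nra|].
            rewrite Rmult_comm, exp_nat; apply Rle_pow; [exact HK | unfold q; lia].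
      -- rewrite leibniz_vanish by (intros; now apply Hout); rewrite Rabs_R0.
         apply Rmult_le_pos; [apply pow_le; lra|].
         apply Rmult_le_pos; [|left; apply HU].
         apply Rmult_le_pos; apply pow_le; [lra | left; now apply Rinv_0_lt_compat].
    * rewrite Nat.add_0_r, Rmult_assoc; apply Rmult_le_compat_l; [apply pow_le; lra|].
      apply Rmult_le_compat_l; [apply pow_le; lra|].
      apply (Rle_div_r _ _ _ (weight_pos (r * n))); rewrite pow_inv, Rmult_assoc, Rmult_comm.
      apply (Rle_div_l _ _ _ (pow_lt _ (r * n) Hmq)), capped_weight.
  + intros i; rewrite leibniz_zero by assumption; simpl; now rewrite Bool.andb_true_r.
  + intros i x Hx; apply leibniz_vanish; intros j; apply Hout.
    eapply Rle_lt_trans; [|exact Hx]; rewrite E4.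
    unfold Rdiv; rewrite !Rmult_assoc; apply Rmult_le_compat_l; [lra|].
    apply (Rle_div_r _ A (m 1%nat) (mpos 1)).
    pose proof (Htail 1%nat q (le_n _)) as H; simpl INR in H; rewrite Rmult_1_r in H.
    assert (HI : INR q * / m q <= psum (fun k => / m (1 + k)%nat) q).
    { rewrite <- psum_const; apply psum_le; intros k Hkq.
      apply Rinv_le_contravar; [apply mpos | apply m_mono; lia]. }
    assert (Hm1 : 0 < m 1%nat) by apply mpos.
    nra.
Qed.

(** Dilation by [t] brings in t^(i - rn): the negative power beats (K H)^n and makes the series
    converge, the positive one goes into [h]. As [h] is chosen before the data, real and imaginary
    parts can share it. *)
Theorem extension_with_bounds (H : R) : 0 < H -> exists h, 0 < h /\
  forall B (b : nat -> R), (forall n, Rabs (b n) <= B * (H ^ n * weight (r * n))) ->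
  exists (F : nat -> R -> R) C, (forall i x, is_derive (F i) x (F (S i) x)) /\
    (forall i x, Rabs (F i x) <= C * (h ^ i * weight i)) /\
    (forall n, F (r * n)%nat 0 = b n) /\
    (forall n j, (1 <= j < r)%nat -> F (r * n + j)%nat 0 = 0) /\
    (forall x, 1 < Rabs x -> F O x = 0).
Proof.
intros HH; destruct cutoff_monomials as [K [R0 [HK [HR0 Hex]]]].
destruct (epsilon_choice _ _ _ Hex) as [chi Hchi]; clear Hex.
(* [t > R0] moves the supports into [-1, 1], and [t ^ r >= 2 * K * H] gives a geometric series of
   ratio 1/2. The factor 2 in [h = 2 * t] takes up the Leibniz loss [2 ^ i]. *)
set (t := 1 + R0 + 2 * K * H).
assert (Ht : 1 <= t) by (unfold t; nra).
assert (Htr : 2 * K * H <= t ^ r).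
{ apply Rle_trans with (t ^ 1); [unfold t; nra|]; now apply Rle_pow. }
exists (2 * t); split; [lra|]; intros B b Hb.
assert (HB : 0 <= B).
{ pose proof (Rle_trans _ _ _ (Rabs_pos _) (Hb O)) as H0.
  rewrite Nat.mul_0_r in H0; unfold weight in H0; simpl in H0; lra. }
assert (Hw := weight_pos).
set (g := fun n i x => b n * / t ^ (r * n) * (t ^ i * chi n i (t * x))).
assert (Hgd : forall n i x, is_derive (g n i) x (g n (S i) x)).
{ intros n i x; unfold g; apply is_derive_scal.
  replace (t ^ S i * chi n (S i) (t * x)) with (t ^ i * (t * chi n (S i) (t * x)))
    by (simpl; ring).
  apply is_derive_scal.
  apply (is_derive_comp (chi n i) (fun y => t * y) x _ t); [apply Hchi|].
  auto_derive; [exact I | apply Rmult_1_r]. }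
assert (Hgb : forall n i x, Rabs (g n i x) <= B * K * ((2 * t) ^ i * weight i) * (/ 2) ^ n).
{ intros n i x; unfold g; rewrite !Rabs_mult.
  assert (Htn : 0 < t ^ (r * n)) by (apply pow_lt; lra).
  assert (Hti : 0 < t ^ i) by (apply pow_lt; lra).
  rewrite (Rabs_pos_eq (/ t ^ (r * n))) by (left; now apply Rinv_0_lt_compat).
  rewrite (Rabs_pos_eq (t ^ i)) by lra.
  apply Rle_trans with (B * (H ^ n * weight (r * n)) * / t ^ (r * n) *
    (t ^ i * (2 ^ i * (K ^ S n * (weight i / weight (r * n)))))).
  - apply Rmult_le_compat.
    + apply Rmult_le_pos; [apply Rabs_pos | left; now apply Rinv_0_lt_compat].
    + apply Rmult_le_pos; [lra | apply Rabs_pos].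
    + apply Rmult_le_compat_r; [left; now apply Rinv_0_lt_compat | apply Hb].
    + apply Rmult_le_compat_l; [lra | apply Hchi].
  - replace (B * (H ^ n * weight (r * n)) * / t ^ (r * n) *
      (t ^ i * (2 ^ i * (K ^ S n * (weight i / weight (r * n))))))
      with (B * K * ((2 * t) ^ i * weight i) * (H ^ n * K ^ n * / t ^ (r * n))).
    2:{ rewrite Rpow_mult_distr; simpl; field; split; [|lra]; apply Rgt_not_eq, Hw. }
    apply Rmult_le_compat_l.
    { specialize (Hw i); assert (0 < (2 * t) ^ i) by (apply pow_lt; lra).
      repeat apply Rmult_le_pos; lra. }
    rewrite <- Rpow_mult_distr, pow_mult, <- pow_inv, <- Rpow_mult_distr.
    apply pow_incr; assert (0 < t ^ r) by (apply pow_lt; lra); split.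
    + apply Rmult_le_pos; [nra | left; now apply Rinv_0_lt_compat].
    + apply Rle_div_l; [assumption | lra]. }
assert (Hgeom : forall N, psum (fun n => (/ 2) ^ n) N <= 2).
{ intros N; apply Rle_trans with (2 - 2 * (/ 2) ^ N).
  - induction N as [|N IH]; simpl; lra.
  - pose proof (pow_lt (/ 2) N ltac:(lra)); lra. }
assert (Hc0 : forall i, 0 <= B * K * ((2 * t) ^ i * weight i)).
{ intros i; specialize (Hw i); assert (0 < (2 * t) ^ i) by (apply pow_lt; lra).
  repeat apply Rmult_le_pos; lra. }
destruct (limit_family (fun N i x => psum (fun n => g n i x) N)
  (fun i => B * K * ((2 * t) ^ i * weight i)) (fun n => (/ 2) ^ n)) as [F [Fd Fl]].
- intros n; apply pow_le; lra.
- apply (series_of_bounded _ 2); [|exact Hgeom]; intros; apply pow_le; lra.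
- exact Hc0.
- intros i N x _; induction N as [|N IH].
  + apply (is_derive_const 0).
  + apply (is_derive_plus (fun x => psum (fun n => g n i x) N)); [exact IH | apply Hgd].
- intros i N x _; simpl psum.
  replace (psum (fun n => g n i x) N + g N i x - psum (fun n => g n i x) N) with (g N i x) by ring.
  apply Hgb.
(* Exact values come from eventually constant partial sums: at 0 at most one dual function
   contributes, outside [-1, 1] none does. *)
- assert (Heq : forall i x c N0, (forall N, (N0 <= N)%nat -> psum (fun n => g n i x) N = c) ->
    F i x = c).
  { intros i x c N0 Hc; specialize (Fl i x).
    apply is_lim_seq_incr_n with (N := N0) in Fl; apply is_lim_seq_unique in Fl.
    rewrite (Lim_seq_ext _ (fun _ => c)), Lim_seq_const in Fl; [now injection Fl|].
    intros N; apply Hc; lia. }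
  exists F, (2 * (B * K)); split; [exact Fd|]; split; [|split; [|split]].
  + intros i x.
    replace (2 * (B * K) * ((2 * t) ^ i * weight i)) with
      (B * K * ((2 * t) ^ i * weight i) * 2) by ring.
    apply (is_lim_seq_le (fun N => Rabs (psum (fun n => g n i x) N))
      (fun _ => B * K * ((2 * t) ^ i * weight i) * 2) (Finite _) (Finite _)).
    * intros N; eapply Rle_trans with (psum (fun n => B * K * ((2 * t) ^ i * weight i) * (/ 2) ^ n) N).
      -- clear Heq Fl; induction N as [|N IH]; [simpl; rewrite Rabs_R0; lra|].
         simpl psum; eapply Rle_trans; [apply Rabs_triang|].
         specialize (Hgb N i x); lra.
      -- rewrite psum_scal; apply Rmult_le_compat_l; [apply Hc0 | apply Hgeom].
    * apply (is_lim_seq_abs _ (Finite _)), Fl.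
    * apply is_lim_seq_const.
  + intros n; apply (Heq _ _ _ (S n)); intros N HN.
    rewrite (psum_single _ n) by
      (try lia; intros k Hk; unfold g; rewrite Rmult_0_r;
       destruct (Hchi k) as [_ [_ [-> _]]];
       replace (Nat.eqb (r * n) (r * k)) with false
         by (symmetry; apply Nat.eqb_neq; nia); ring).
    unfold g; rewrite Rmult_0_r; destruct (Hchi n) as [_ [_ [-> _]]].
    rewrite Nat.eqb_refl; field; apply pow_nonzero; lra.
  + intros n j Hj; apply (Heq _ _ _ O); intros N _; apply psum_zero; intros k _.
    unfold g; rewrite Rmult_0_r; destruct (Hchi k) as [_ [_ [-> _]]].
    replace (Nat.eqb (r * n + j) (r * k)) with false; [ring|].
    symmetry; apply Nat.eqb_neq; intros E.
    assert (n < k < S n)%nat; [|lia].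
    split; apply (Nat.mul_lt_mono_pos_l r); lia.
  + intros x Hx; apply (Heq _ _ _ O); intros N _; apply psum_zero; intros k _.
    unfold g; destruct (Hchi k) as [_ [_ [_ ->]]]; [ring|].
    rewrite Rabs_mult, (Rabs_pos_eq t) by lra.
    apply Rlt_le_trans with (t * 1); [unfold t; nra | apply Rmult_le_compat_l; lra].
Qed.

End Extension.

(** * Replacing the weight by a slightly smaller one *)

Lemma INR_le_pow2 n : INR n <= 2 ^ n.
Proof.
induction n as [|n IH]; [simpl; lra|].
rewrite S_INR; simpl; pose proof (pow_R1_Rle 2 n ltac:(lra)); lra.
Qed.

Lemma eventually_decreasing_bounded (z : nat -> R) k0 :
  (forall k, (k0 <= k)%nat -> z (S k) <= z k) -> exists C, forall k, z k <= C.
Proof.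
revert z; induction k0 as [|k0 IH]; intros z H.
- exists (z O); intros k; induction k as [|k IHk]; [lra|].
  specialize (H k (Nat.le_0_l k)); lra.
- destruct (IH (fun k => z (S k))) as [C HC]; [intros k Hk; apply H; lia|].
  exists (Rmax (z O) C); intros [|k]; [apply Rmax_l|].
  eapply Rle_trans; [apply HC | apply Rmax_r].
Qed.

Section SlowSequence.

Variables (r : nat) (b : nat -> R) (delta : R).
Hypothesis Hdelta : 0 < delta.
Hypothesis bpos : forall n, 0 <= b n.
Hypothesis bsmall : forall eps, 0 < eps -> exists C, forall n, b n <= C * eps ^ n.

Definition allowed (k : nat) (t : R) : Prop :=
  forall n, (k <= n)%nat -> b n * t ^ (r * n) <= 1.

(** Greedy: the value rises by [delta / k] whenever [b] tolerates the raised value from index [k]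
    on. Harmonic steps are small enough for [slowly_reduced], yet their sum diverges. *)
Fixpoint slow (k : nat) : R :=
  match k with
  | O => 1
  | S k' => if excluded_middle_informative (allowed k (slow k' + delta / INR k))
            then slow k' + delta / INR k else slow k'
  end.

Lemma slow_step k : slow k <= slow (S k) <= slow k + delta / INR (S k).
Proof.
assert (0 < delta / INR (S k)) by (apply Rdiv_lt_0_compat; [exact Hdelta | apply lt_0_INR; lia]).
change (slow (S k)) with (if excluded_middle_informative
  (allowed (S k) (slow k + delta / INR (S k))) then slow k + delta / INR (S k) else slow k).
destruct excluded_middle_informative; lra.
Qed.

Lemma slow_mono j k : (j <= k)%nat -> slow j <= slow k.
Proof. induction 1 as [|k _ IH]; [lra|]; pose proof (slow_step k); lra. Qed.

Lemma slow_ge1 k : 1 <= slow k.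
Proof. apply (slow_mono O k); lia. Qed.

(** The value [slow n] was allowed when it was last raised, at an index at most [n]; [C1] covers the
    initial value 1. *)
Lemma slow_small : exists C, forall n, b n * slow n ^ (r * n) <= C.
Proof.
destruct (bsmall 1 Rlt_0_1) as [C1 HC1]; exists (Rmax 1 C1).
assert (Q : forall k n, (k <= n)%nat -> b n * slow k ^ (r * n) <= Rmax 1 C1).
{ induction k as [|k IH]; intros n Hn.
  - simpl; rewrite pow1, Rmult_1_r; specialize (HC1 n); rewrite pow1, Rmult_1_r in HC1.
    eapply Rle_trans; [exact HC1 | apply Rmax_r].
  - change (slow (S k)) with (if excluded_middle_informative
      (allowed (S k) (slow k + delta / INR (S k))) then slow k + delta / INR (S k) else slow k).
    destruct excluded_middle_informative as [Hal|_].
    + eapply Rle_trans; [now apply Hal | apply Rmax_l].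
    + apply IH; lia. }
intros n; now apply Q.
Qed.

Lemma eventually_allowed T : 0 < T -> exists k0, allowed k0 T.
Proof.
intros HT; assert (HTr : 0 < T ^ r) by now apply pow_lt.
destruct (bsmall (/ (2 * T ^ r))) as [C HC]; [apply Rinv_0_lt_compat; lra|].
destruct (INR_unbounded C) as [k0 Hk0].
exists k0; intros n Hn.
assert (HTn : 0 < (T ^ r) ^ n) by now apply pow_lt.
rewrite pow_mult; apply Rle_trans with (C * (/ (2 * T ^ r)) ^ n * (T ^ r) ^ n).
{ apply Rmult_le_compat_r; [lra | apply HC]. }
rewrite Rmult_assoc, <- Rpow_mult_distr.
replace (/ (2 * T ^ r) * T ^ r) with (/ 2) by (field; lra).
rewrite pow_inv; apply (Rle_div_l C); [apply pow_lt; lra|].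
pose proof (INR_le_pow2 n); pose proof (le_INR _ _ Hn); lra.
Qed.

(** If [slow] stayed below [T], every raised value would be at most [T + delta], which is eventually
    allowed. Then all steps would be taken, and each doubling of the index would add [delta / 2]. *)
Lemma slow_unbounded T : exists k, T <= slow k.
Proof.
apply NNPP; intros Hn.
assert (HT : forall k, slow k < T).
{ intros k; apply Rnot_le_lt; intros Hk; apply Hn; now exists k. }
assert (HT1 : 1 < T) by (apply (HT O)).
destruct (eventually_allowed (T + delta)) as [k0 Hk0]; [lra|].
assert (Hstep : forall k, (k0 <= k)%nat -> slow (S k) = slow k + delta / INR (S k)).
{ intros k Hk; change (slow (S k)) with (if excluded_middle_informative
    (allowed (S k) (slow k + delta / INR (S k))) then slow k + delta / INR (S k) else slow k).
  destruct excluded_middle_informative as [_|Hno]; [reflexivity|].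
  exfalso; apply Hno; intros n Hkn.
  eapply Rle_trans; [|apply (Hk0 n); lia].
  apply Rmult_le_compat_l; [apply bpos|].
  assert (1 <= INR (S k)) by (apply (le_INR 1); lia).
  assert (0 < delta / INR (S k)) by (apply Rdiv_lt_0_compat; lra).
  pose proof (slow_ge1 k); pose proof (HT k).
  apply pow_incr; split; [lra|]; apply Rplus_le_compat; [lra|].
  apply Rle_div_l; nra. }
assert (Hdouble : forall k, (k0 <= k)%nat -> (1 <= k)%nat ->
  slow k + delta / 2 <= slow (k + k)).
{ intros k Hk Hk1.
  assert (Hk0' : 0 < INR k) by (apply lt_0_INR; lia).
  assert (Hj : forall j, (j <= k)%nat -> slow k + INR j * (delta / (2 * INR k)) <= slow (k + j)).
  { induction j as [|j IH]; intros Hj; [rewrite Nat.add_0_r; simpl; lra|].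
    rewrite Nat.add_succ_r, Hstep by lia; rewrite S_INR; specialize (IH ltac:(lia)).
    assert (delta / (2 * INR k) <= delta / INR (S (k + j))); [|lra].
    apply Rmult_le_compat_l; [lra|]; apply Rinv_le_contravar; [apply lt_0_INR; lia|].
    replace (2 * INR k) with (INR (k + k)) by (rewrite plus_INR; ring).
    apply le_INR; lia. }
  specialize (Hj k (le_n _)).
  replace (INR k * (delta / (2 * INR k))) with (delta / 2) in Hj by (field; lra); exact Hj. }
assert (Hmany : forall i, exists k, (S k0 <= k)%nat /\ INR i * (delta / 2) <= slow k).
{ induction i as [|i [k [Hk IH]]].
  - exists (S k0); split; [lia|]; simpl; pose proof (slow_ge1 (S k0)); simpl in *; lra.
  - exists (k + k)%nat; split; [lia|]; rewrite S_INR.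
    pose proof (Hdouble k ltac:(lia) ltac:(lia)); lra. }
destruct (INR_unbounded (T / (delta / 2))) as [i Hi].
destruct (Hmany i) as [k [_ Hk]]; specialize (HT k).
apply Rlt_div_l in Hi; lra.
Qed.

End SlowSequence.

(** Restores the monotonicity that [m k / theta k] may lack. The maximum is over 1 <= j <= k, with
    [g 1] at 0. *)
Fixpoint running_max (g : nat -> R) (k : nat) : R :=
  match k with O => g 1%nat | S k' => Rmax (running_max g k') (g k) end.

Lemma running_max_le g k B :
  (forall j, (1 <= j <= Nat.max k 1)%nat -> g j <= B) -> running_max g k <= B.
Proof.
induction k as [|k IH]; intros H; simpl; [apply H; lia|].
apply Rmax_lub; [apply IH; intros; apply H; lia | apply H; lia].
Qed.

Lemma running_max_ge g k : (1 <= k)%nat -> g k <= running_max g k.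
Proof. destruct k; [lia|]; intros _; apply Rmax_r. Qed.

Lemma running_max_pos g k : (forall j, 0 < g j) -> 0 < running_max g k.
Proof.
intros H; destruct k; [apply H|]; eapply Rlt_le_trans; [apply H | apply Rmax_r].
Qed.

(** The steps [/ A / k] of [theta] are calibrated to the tail bound: passing to the running maximum
    and summing [theta k / m k] each lose a factor 2, hence [4 * A]. *)
Lemma slowly_reduced (m theta : nat -> R) A : (forall k, 0 < m k) -> (forall k, m k <= m (S k)) ->
  tail_bound m A -> (forall k, 1 <= theta k) ->
  (forall k, theta k <= theta (S k) <= theta k + / A / INR (S k)) ->
  let m' := running_max (fun k => m k / theta k) in
  tail_bound m' (4 * A) /\ forall k, (1 <= k)%nat -> m' k <= 2 * (m k / theta k).
Proof.
intros mpos mincr Htail th1 thstep m'.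
assert (HA := tail_bound_ge1 m A mpos Htail).
assert (HAi : 0 < / A) by (apply Rinv_0_lt_compat; lra).
assert (Hth : forall j k, (1 <= j)%nat -> theta (j + k)%nat <= theta j + / A * (INR k / INR j)).
{ intros j k Hj; assert (0 < INR j) by (apply lt_0_INR; lia).
  induction k as [|k IH]; [rewrite Nat.add_0_r; simpl; lra|].
  rewrite Nat.add_succ_r, S_INR.
  pose proof (thstep (j + k)%nat) as T.
  assert (/ A / INR (S (j + k)) <= / A * (1 / INR j)).
  { apply Rmult_le_compat_l; [lra|]; unfold Rdiv; rewrite Rmult_1_l.
    apply Rinv_le_contravar; [lra | apply le_INR; lia]. }
  replace ((INR k + 1) / INR j) with (INR k / INR j + 1 / INR j) by (field; lra); lra. }
(* The first [k] terms of the tail at [j] are each at least [/ m (j + k)]. *)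
assert (Hm : forall j k, (1 <= j)%nat -> m j * INR k <= A * INR j * m (j + k)%nat).
{ intros j k Hj.
  assert (Hp : INR k * / m (j + k)%nat <= psum (fun i => / m (j + i)%nat) k).
  { rewrite <- psum_const; apply psum_le; intros i Hi.
    apply Rinv_le_contravar; [apply mpos | apply m_mono; [exact mincr | lia]]. }
  pose proof (Htail j k Hj) as T; pose proof (mpos j) as Hmj; pose proof (mpos (j + k)%nat) as Hmk.
  apply Rmult_le_compat_l with (r := m j) in Hp; [|lra].
  apply Rmult_le_reg_r with (/ m (j + k)%nat); [now apply Rinv_0_lt_compat|].
  replace (A * INR j * m (j + k)%nat * / m (j + k)%nat) with (A * INR j) by (field; lra); lra. }
assert (Hup : forall k, (1 <= k)%nat -> m' k <= 2 * (m k / theta k)).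
(* By [Hth] and [Hm], m j theta (j+d) <= m j theta j + m (j+d), which is at most 2 m (j+d) theta
   j. *)
{ intros k Hk; apply running_max_le; intros j Hj.
  replace k with (j + (k - j))%nat by lia; set (d := (k - j)%nat).
  assert (Hj0 : 0 < INR j) by (apply lt_0_INR; lia).
  pose proof (th1 j) as t1; pose proof (th1 (j + d)%nat) as t2.
  pose proof (mpos j) as Hmj; pose proof (m_mono m mincr j (j + d) ltac:(lia)) as Hmm.
  apply Rle_div_l; [lra|]; replace (2 * (m (j + d)%nat / theta (j + d)%nat) * theta j)
    with (2 * m (j + d)%nat * theta j / theta (j + d)%nat) by (field; lra).
  apply (Rle_div_r (m j)); [lra|].
  apply Rle_trans with (m j * (theta j + / A * (INR d / INR j))).
  { apply Rmult_le_compat_l; [lra | apply Hth; lia]. }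
  assert (m j * (/ A * (INR d / INR j)) <= m (j + d)%nat).
  { replace (m j * (/ A * (INR d / INR j))) with (m j * INR d / (A * INR j)) by (field; lra).
    apply Rle_div_l; [nra|]; pose proof (Hm j d ltac:(lia)); lra. }
  nra. }
split; [|exact Hup].
(* Summation by parts: the increment of [theta] at [n] multiplies the tail beyond [n], and the tail
   bound makes this product at most [/ m n]. The term + 1 absorbs it. *)
assert (Habel : forall L n, (1 <= n)%nat ->
  psum (fun k => theta (n + k)%nat * / m (n + k)%nat) L
    <= (theta n + 1) * psum (fun k => / m (n + k)%nat) L).
{ induction L as [|L IH]; intros n Hn; [simpl; lra|].
  rewrite !psum_S_l, Nat.add_0_r.
  rewrite (psum_ext (fun k => theta (n + S k)%nat * / m (n + S k)%nat)
    (fun k => theta (S n + k)%nat * / m (S n + k)%nat))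
    by (intros k _; now rewrite Nat.add_succ_r).
  rewrite (psum_ext (fun k => / m (n + S k)%nat) (fun k => / m (S n + k)%nat))
    by (intros k _; now rewrite Nat.add_succ_r).
  specialize (IH (S n) ltac:(lia)).
  pose proof (Htail (S n) L ltac:(lia)) as T.
  assert (HT0 : 0 <= psum (fun k => / m (S n + k)%nat) L).
  { apply psum_nonneg; intros; left; apply Rinv_0_lt_compat, mpos. }
  set (T' := psum (fun k => / m (S n + k)%nat) L) in *.
  assert (Hw : / A / INR (S n) * T' <= / m n).
  { assert (0 < INR (S n)) by (apply lt_0_INR; lia).
    apply Rle_trans with (/ m (S n)).
    - replace (/ A / INR (S n) * T') with (T' / (A * INR (S n))) by (field; lra).
      apply Rle_div_l; [nra|]; pose proof (mpos (S n)).
      apply Rmult_le_reg_l with (m (S n)); [assumption|].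
      rewrite <- Rmult_assoc, Rinv_r, Rmult_1_l by lra; exact T.
    - apply Rinv_le_contravar; [apply mpos | apply mincr]. }
  pose proof (thstep n) as [_ Hs].
  apply Rmult_le_compat_r with (r := T') in Hs; [|exact HT0]; lra. }
intros n L Hn.
pose proof (th1 n) as t1; pose proof (mpos n) as Hmn.
assert (HW0 : 0 <= psum (fun k => / m (n + k)%nat) L).
{ apply psum_nonneg; intros; left; apply Rinv_0_lt_compat, mpos. }
assert (Hsum : psum (fun k => / m' (n + k)%nat) L
  <= 2 * theta n * psum (fun k => / m (n + k)%nat) L).
{ eapply Rle_trans; [apply (psum_le _ (fun k => theta (n + k)%nat * / m (n + k)%nat))|].
  - intros k _; pose proof (mpos (n + k)%nat); pose proof (th1 (n + k)%nat).
    replace (theta (n + k)%nat * / m (n + k)%nat) with (/ (m (n + k)%nat / theta (n + k)%nat))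
      by (field; lra).
    apply Rinv_le_contravar; [apply Rdiv_lt_0_compat; lra|].
    apply (running_max_ge (fun k => m k / theta k)); lia.
  - eapply Rle_trans; [now apply Habel|]; apply Rmult_le_compat_r; lra. }
assert (0 <= psum (fun k => / m' (n + k)%nat) L).
{ apply psum_nonneg; intros; left; apply Rinv_0_lt_compat, running_max_pos.
  intros j; apply Rdiv_lt_0_compat; [apply mpos | specialize (th1 j); lra]. }
apply Rle_trans with (2 * (m n / theta n) * (2 * theta n * psum (fun k => / m (n + k)%nat) L)).
{ apply Rmult_le_compat; auto; left; apply running_max_pos.
  intros j; apply Rdiv_lt_0_compat; [apply mpos | specialize (th1 j); lra]. }
replace (2 * (m n / theta n) * (2 * theta n * psum (fun k => / m (n + k)%nat) L))
  with (4 * (m n * psum (fun k => / m (n + k)%nat) L)) by (field; lra).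
pose proof (Htail n L Hn); lra.
Qed.

(** Reduces the Beurling case to a single rate. Since [theta] is nondecreasing, replacing [m] by
    [m'] loses at most theta n ^ (r n) at order [r * n], which [b] absorbs by [slow_small]. Since
    [theta] is unbounded, the new weight is below the old one at every rate [h]. *)
Lemma smaller_weight (r : nat) (m b : nat -> R) A : (1 <= r)%nat ->
  (forall k, 0 < m k) -> (forall k, m k <= m (S k)) -> tail_bound m A ->
  (forall n, 0 <= b n) -> (forall eps, 0 < eps -> exists C, forall n, b n <= C * eps ^ n) ->
  exists m', (forall k, 0 < m' k) /\ (forall k, m' k <= m' (S k)) /\ tail_bound m' (4 * A) /\
    (exists C, forall n, b n * weight r m (r * n) <= C * weight r m' (r * n)) /\
    (forall h, 0 < h -> exists C, forall k,
       weight r m' (r * k) <= C * (h ^ k * weight r m (r * k))).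
Proof.
intros Hr mpos mincr Htail bpos bsmall.
assert (HA := tail_bound_ge1 m A mpos Htail).
assert (HAi : 0 < / A) by (apply Rinv_0_lt_compat; lra).
set (theta := slow r b (/ A)).
assert (th1 : forall k, 1 <= theta k) by now apply slow_ge1.
assert (thpos : forall j, 0 < m j / theta j).
{ intros j; apply Rdiv_lt_0_compat; [apply mpos | specialize (th1 j); lra]. }
destruct (slowly_reduced m theta A mpos mincr Htail th1) as [Ht Hup].
{ now apply slow_step. }
set (m' := running_max (fun k => m k / theta k)) in *.
assert (m'pos : forall k, 0 < m' k) by (intros; now apply running_max_pos).
exists m'; split; [exact m'pos|]; split; [intros; apply Rmax_l|]; split; [exact Ht|]; split.
- destruct (slow_small r b (/ A) bsmall) as [C HC]; exists C; intros n.
  rewrite !weight_mul by exact Hr.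
  assert (Hp : 0 <= pprod (fun l => m (S l)) n <= pprod (fun l => theta n * m' (S l)) n).
  { apply pprod_le; intros k Hk; split; [left; apply mpos|].
    pose proof (th1 (S k)); pose proof (mpos (S k)).
    assert (H1 : m (S k) / theta (S k) <= m' (S k))
      by (apply (running_max_ge (fun k => m k / theta k)); lia).
    apply Rle_div_l in H1; [|lra].
    assert (theta (S k) <= theta n) by (now apply slow_mono).
    pose proof (m'pos (S k)); nra. }
  assert (E : pprod (fun l => theta n * m' (S l)) n = theta n ^ n * pprod (fun l => m' (S l)) n).
  { apply pprod_scal. }
  rewrite E in Hp.
  assert (Hp2 : pprod (fun l => m (S l)) n ^ r
    <= theta n ^ (r * n) * pprod (fun l => m' (S l)) n ^ r).
  { rewrite Nat.mul_comm, pow_mult, <- Rpow_mult_distr; now apply pow_incr. }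
  eapply Rle_trans; [apply Rmult_le_compat_l; [apply bpos | exact Hp2]|].
  rewrite <- Rmult_assoc; apply Rmult_le_compat_r; [|apply HC].
  apply pow_le; left; apply pprod_pos; intros; apply m'pos.
- intros h Hh; set (eta := Rmin 1 h).
  assert (He : 0 < eta) by (apply Rmin_glb_lt; lra).
  assert (He1 : eta <= 1) by apply Rmin_l.
  assert (Heh : eta <= h) by apply Rmin_r.
  assert (Her : eta ^ r <= h).
  { destruct r as [|r']; [lia|]; simpl.
    assert (0 < eta ^ r') by now apply pow_lt.
    assert (eta ^ r' <= 1) by (rewrite <- (pow1 r'); apply pow_incr; lra). nra. }
  (* The 2 cancels the factor 2 of [Hup], so that eventually [m' <= eta * m]. *)
  destruct (slow_unbounded r b (/ A) HAi bpos bsmall (2 / eta)) as [k0 Hk0].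
  set (P := fun f => pprod (fun l => f (S l) : R)).
  assert (Pm : forall k, 0 < P m k) by (intros; apply pprod_pos; intros; apply mpos).
  assert (Pm' : forall k, 0 < P m' k) by (intros; apply pprod_pos; intros; apply m'pos).
  destruct (eventually_decreasing_bounded (fun k => P m' k / (eta ^ k * P m k)) k0) as [C HC].
  { intros k Hk.
    assert (Hek : 0 < eta ^ k) by now apply pow_lt.
    specialize (Pm k); specialize (Pm' k); pose proof (mpos (S k)) as Hmk.
    assert (Hth : 2 / eta <= theta (S k)).
    { eapply Rle_trans; [exact Hk0|]; apply (slow_mono r b (/ A) HAi); lia. }
    assert (Hmm : m' (S k) <= eta * m (S k)).
    { eapply Rle_trans; [apply Hup; lia|].
      pose proof (th1 (S k)).
      apply Rle_div_l in Hth; [|lra].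
      replace (2 * (m (S k) / theta (S k))) with (2 * m (S k) / theta (S k)) by (field; lra).
      apply Rle_div_l; [lra|]; nra. }
    change (P m' (S k)) with (P m' k * m' (S k)); change (P m (S k)) with (P m k * m (S k)).
    apply Rle_div_l; [simpl; repeat apply Rmult_lt_0_compat; assumption|].
    replace (P m' k / (eta ^ k * P m k) * (eta ^ S k * (P m k * m (S k))))
      with (P m' k * (eta * m (S k))) by (simpl; field; lra).
    apply Rmult_le_compat_l; lra. }
  exists (C ^ r); intros k; rewrite !weight_mul by exact Hr; fold (P m' k) (P m k).
  specialize (HC k); simpl in HC.
  assert (Hek : 0 < eta ^ k) by now apply pow_lt.
  specialize (Pm k); specialize (Pm' k).
  apply Rle_div_l in HC; [|now apply Rmult_lt_0_compat].
  assert (HC0 : 0 <= C).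
  { apply Rmult_le_reg_r with (eta ^ k * P m k); [now apply Rmult_lt_0_compat|]; lra. }
  apply Rle_trans with ((C * (eta ^ k * P m k)) ^ r); [apply pow_incr; lra|].
  rewrite !Rpow_mult_distr; apply Rmult_le_compat_l; [now apply pow_le|].
  apply Rmult_le_compat_r; [apply pow_le; lra|].
  rewrite <- pow_mult, Nat.mul_comm, pow_mult; apply pow_incr; split; [|exact Her].
  apply pow_le; lra.
Qed.

(** * Log-convex sequences *)

Lemma Cmod_le_2 (z : C) B : Rabs (Re z) <= B -> Rabs (Im z) <= B -> Cmod z <= 2 * B.
Proof.
intros H1 H2; eapply Rle_trans; [apply Cmod_2Rmax|].
assert (Hm : Rmax (Rabs (fst z)) (Rabs (snd z)) <= B) by (apply Rmax_lub; assumption).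
assert (0 <= Rmax (Rabs (fst z)) (Rabs (snd z)))
  by (eapply Rle_trans; [apply Rabs_pos | apply Rmax_l]).
assert (sqrt 2 <= 2).
{ rewrite <- (sqrt_pow2 2) at 2 by lra; apply sqrt_le_1; lra. }
pose proof (sqrt_pos 2); nra.
Qed.

Lemma im_le_Cmod (z : C) : Rabs (Im z) <= Cmod z.
Proof. eapply Rle_trans; [apply Rmax_r | apply Rmax_Cmod]. Qed.

Lemma extension_complex (r : nat) (m : nat -> R) A H : (1 <= r)%nat ->
  (forall k, 0 < m k) -> (forall k, m k <= m (S k)) -> tail_bound m A -> 0 < H ->
  exists h, 0 < h /\ forall B (a : nat -> C),
    (forall n, Cmod (a n) <= B * (H ^ n * weight r m (r * n))) ->
    exists f C, D_base r f /\ (forall j, Borel r f j = a j) /\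
      forall n x, Cmod (CDerive_n f (r * n) x) <= C * (h ^ n * weight r m (r * n)).
Proof.
intros Hr mpos mincr Htail HH.
destruct (extension_with_bounds r m A Hr mpos mincr Htail H HH) as [h [Hh Hext]].
exists (h ^ r); split; [now apply pow_lt|]; intros B a Ha.
destruct (Hext B (fun n => Re (a n))) as [F1 [C1 [D1 [B1 [V1 [Z1 S1]]]]]].
{ intros n; eapply Rle_trans; [apply re_le_Cmod | apply Ha]. }
destruct (Hext B (fun n => Im (a n))) as [F2 [C2 [D2 [B2 [V2 [Z2 S2]]]]]].
{ intros n; eapply Rle_trans; [apply im_le_Cmod | apply Ha]. }
set (f := fun x => (F1 O x, F2 O x) : C).
destruct (is_derive_smooth f (fun n x => (F1 n x, F2 n x))) as [Hsm HD].
{ reflexivity. }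
{ intros n x; apply is_derive_C; split; [apply D1 | apply D2]. }
exists f, (2 * Rmax C1 C2); split; [|split].
- split; [exact Hsm| |].
  + intros x Hx; apply Rabs_le_between, Rnot_lt_le; intros Hlt; apply Hx.
    unfold f; now rewrite S1, S2.
  + intros n j Hj; rewrite HD; now rewrite Z1, Z2.
- intros j; unfold Borel; rewrite HD, V1, V2; destruct (a j); reflexivity.
- intros n x; rewrite HD, Rmult_assoc, <- pow_mult.
  assert (Hp : 0 <= h ^ (r * n) * weight r m (r * n)).
  { apply Rmult_le_pos; [apply pow_le; lra | left; now apply weight_pos]. }
  apply Cmod_le_2; simpl.
  + eapply Rle_trans; [apply B1|]; apply Rmult_le_compat_r; [exact Hp | apply Rmax_l].
  + eapply Rle_trans; [apply B2|]; apply Rmult_le_compat_r; [exact Hp | apply Rmax_r].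
Qed.

Definition root (r : nat) (M : nat -> R) (k : nat) : R := Rpower (mu M k) (/ INR r).

Lemma root_pos r M k : 0 < root r M k.
Proof. apply exp_pos. Qed.

Lemma Rpower_pow_inv x n : (1 <= n)%nat -> 0 < x -> Rpower x (/ INR n) ^ n = x.
Proof.
intros Hn Hx; rewrite <- Rpower_pow by apply exp_pos.
rewrite Rpower_mult, Rinv_l, Rpower_1; auto.
apply not_0_INR; lia.
Qed.

Lemma Rpower_Rinv x y : 0 < x -> Rpower (/ x) y = / Rpower x y.
Proof. intros Hx; rewrite <- Rpower_Ropp; unfold Rpower; rewrite ln_Rinv by exact Hx; f_equal; ring. Qed.

Section LogConvex.

Variable M : nat -> R.
Hypothesis HM : LC M.

Lemma mu_pos k : 0 < mu M k.
Proof.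
destruct k; simpl; [lra|]; apply Rdiv_lt_0_compat; apply (LC_pos _ HM).
Qed.

Lemma mu_incr k : mu M k <= mu M (S k).
Proof.
assert (Hp := LC_pos _ HM).
destruct k as [|k].
- simpl; rewrite (LC_norm0 _ HM); pose proof (LC_norm1 _ HM); lra.
- pose proof (LC_logconvex _ HM (S k) ltac:(lia)) as H.
  replace (S k - 1)%nat with k in H by lia; replace (S k + 1)%nat with (S (S k)) in H by lia.
  change (M (S k) / M k <= M (S (S k)) / M (S k)).
  pose proof (Hp k); pose proof (Hp (S k)).
  apply Rle_div_l; [lra|].
  replace (M (S (S k)) / M (S k) * M k) with (M (S (S k)) * M k / M (S k)) by (field; lra).
  apply (Rle_div_r (M (S k))); [lra|]; lra.
Qed.

Lemma mu_mono j k : (j <= k)%nat -> mu M j <= mu M k.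
Proof. apply m_mono, mu_incr. Qed.

Lemma mu_succ k : M (S k) = M k * mu M (S k).
Proof. simpl; field; apply Rgt_not_eq, (LC_pos _ HM). Qed.

Lemma M_le_mu j d : M (j + d)%nat <= M j * mu M (j + d) ^ d.
Proof.
pose proof (LC_pos _ HM) as Hp.
assert (H : forall c, (forall i, (i < d)%nat -> mu M (j + S i) <= c) -> M (j + d)%nat <= M j * c ^ d).
{ intros c; induction d as [|d IH]; intros Hc; [rewrite Nat.add_0_r; simpl; lra|].
  rewrite Nat.add_succ_r, mu_succ; cbn [pow].
  assert (M (j + d)%nat <= M j * c ^ d) by (apply IH; intros; apply Hc; lia).
  pose proof (Hc d ltac:(lia)) as Hd; rewrite Nat.add_succ_r in Hd.
  pose proof (mu_pos (S (j + d))); pose proof (Hp (j + d)%nat).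
  replace (M j * (c * c ^ d)) with (M j * c ^ d * c) by ring.
  apply Rmult_le_compat; lra. }
apply H; intros i Hi; apply mu_mono; lia.
Qed.

Lemma M_ge_mu j d : M j * mu M j ^ d <= M (j + d)%nat.
Proof.
pose proof (LC_pos _ HM) as Hp.
induction d as [|d IH]; [rewrite Nat.add_0_r; simpl; lra|].
rewrite Nat.add_succ_r, mu_succ; cbn [pow].
replace (M j * (mu M j * mu M j ^ d)) with (M j * mu M j ^ d * mu M j) by ring.
apply Rmult_le_compat; [|left; apply mu_pos | exact IH | apply mu_mono; lia].
left; apply Rmult_lt_0_compat; [apply Hp | apply pow_lt, mu_pos].
Qed.

(** [lambda] is [real] of an extended supremum, so finiteness must be known first: [j = 0] gives a
    member, and M p <= M j (mu p)^(p-j) with s >= 1 gives the bound. *)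
Lemma lambda_lub p s : (1 <= p)%nat -> (1 <= s)%nat ->
  is_lub_Rbar (fun y => exists j, (j < p)%nat /\
    y = Rpower (M p / (INR s ^ p * M j)) (/ INR (p - j))) (Finite (lambda M p s)) /\
  lambda M p s <= mu M p.
Proof.
intros Hp Hs; pose proof (LC_pos _ HM) as HMp.
set (E := fun y => exists j, (j < p)%nat /\
    y = Rpower (M p / (INR s ^ p * M j)) (/ INR (p - j))).
assert (Hub : is_ub_Rbar E (Finite (mu M p))).
{ intros y [j [Hj ->]]; simpl.
  rewrite <- (Rpower_1 (mu M p)) by apply mu_pos.
  rewrite <- (Rinv_r (INR (p - j))) by (apply not_0_INR; lia).
  rewrite <- Rpower_mult, Rpower_pow by apply mu_pos.
  assert (Hs1 : 1 <= INR s ^ p) by (apply pow_R1_Rle, (le_INR 1), Hs).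
  pose proof (HMp j) as Hj0; pose proof (HMp p) as Hp0.
  assert (Hsj : 0 < INR s ^ p * M j) by nra.
  apply Rle_Rpower_l; [left; apply Rinv_0_lt_compat, lt_0_INR; lia|]; split.
  - now apply Rdiv_lt_0_compat.
  - apply Rle_div_l; [exact Hsj|].
    pose proof (M_le_mu j (p - j)) as H; replace (j + (p - j))%nat with p in H by lia.
    assert (0 < mu M p ^ (p - j)) by apply pow_lt, mu_pos.
    assert (M j * mu M p ^ (p - j) <= mu M p ^ (p - j) * (INR s ^ p * M j)); [|lra].
    nra. }
assert (Hl := Lub_Rbar_correct E).
assert (Hfin : is_finite (Lub_Rbar E)).
{ destruct Hl as [Hl1 Hl2]; specialize (Hl2 _ Hub).
  specialize (Hl1 _ (ex_intro _ O (conj (Nat.lt_le_trans _ _ _ Nat.lt_0_1 Hp) eq_refl))).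
  destruct (Lub_Rbar E); simpl in *; [reflexivity | contradiction..]. }
unfold lambda; fold E; rewrite Hfin; split; [exact Hl|].
destruct Hl as [_ Hl2]; specialize (Hl2 _ Hub); rewrite <- Hfin in Hl2; exact Hl2.
Qed.

Variable r : nat.
Hypothesis Hr : (1 <= r)%nat.

Lemma root_pow k : root r M k ^ r = mu M k.
Proof. apply Rpower_pow_inv; [exact Hr | apply mu_pos]. Qed.

Lemma root_mono j k : (j <= k)%nat -> root r M j <= root r M k.
Proof.
intros H; apply Rle_Rpower_l; [left; apply Rinv_0_lt_compat, lt_0_INR; lia|].
split; [apply mu_pos | now apply mu_mono].
Qed.

Lemma root_incr k : root r M k <= root r M (S k).
Proof. apply root_mono; lia. Qed.

Lemma weight_root k : weight r (root r M) (r * k) = M k.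
Proof.
rewrite weight_mul by exact Hr; induction k as [|k IH].
- simpl; rewrite pow1; symmetry; apply (LC_norm0 _ HM).
- simpl pprod; rewrite Rpow_mult_distr, IH, root_pow; symmetry; apply mu_succ.
Qed.

(** For positive terms, bounded partial sums yield both the convergence and the size of the series.
    A general [c] serves [mu] and [lambda] alike. *)
Lemma gamma_cond_iff c : gamma_cond r M c <->
  exists A, forall p n, (1 <= p)%nat ->
    Rpower (c p) (/ INR r) * psum (fun k => / root r M (p + k)) n <= A * INR p.
Proof.
assert (E : forall p k, Rpower (/ mu M (p + k)) (/ INR r) = / root r M (p + k)).
{ intros p k; apply Rpower_Rinv, mu_pos. }
assert (Hpos : forall p k, 0 <= / root r M (p + k)).
{ intros; left; apply Rinv_0_lt_compat, root_pos. }
assert (Hc : forall p, 0 < Rpower (c p) (/ INR r)) by (intros; apply exp_pos).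
split; intros [A HA]; exists A.
- intros p n Hp; destruct (HA p Hp) as [Hs HB].
  assert (Hp0 : 0 < INR p) by (apply lt_0_INR; lia).
  apply (ex_series_ext _ _ (E p)) in Hs; rewrite (Series_ext _ _ (E p)) in HB.
  replace (Rpower (c p) (/ INR r) / INR p * Series (fun k => / root r M (p + k)))
    with (Rpower (c p) (/ INR r) * Series (fun k => / root r M (p + k)) / INR p) in HB
    by (field; lra).
  apply Rle_div_l in HB; [|lra].
  eapply Rle_trans; [|exact HB]; apply Rmult_le_compat_l; [left; apply Hc|].
  now apply psum_le_Series.
- intros p Hp; specialize (fun n => HA p n Hp).
  assert (Hp0 : 0 < INR p) by (apply lt_0_INR; lia).
  destruct (series_of_bounded (fun k => / root r M (p + k)) (A * INR p / Rpower (c p) (/ INR r)))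
    as [Hs HB]; [apply Hpos| |].
  { intros n; apply (Rle_div_r _ _ _ (Hc p)); rewrite Rmult_comm; apply HA. }
  split; [apply (ex_series_ext (fun k => / root r M (p + k))); [now intros; rewrite E | exact Hs]|].
  rewrite (Series_ext _ _ (E p)).
  apply (Rle_div_r _ _ _ (Hc p)) in HB.
  replace (Rpower (c p) (/ INR r) / INR p * Series (fun k => / root r M (p + k)))
    with (Series (fun k => / root r M (p + k)) * Rpower (c p) (/ INR r) / INR p) by (field; lra).
  apply Rle_div_l; lra.
Qed.

Lemma gamma_cond_mu_iff : gamma_cond r M (mu M) <-> exists A, tail_bound (root r M) A.
Proof. apply gamma_cond_iff. Qed.

Lemma gamma_cond_lambda :
  (exists s, (1 <= s)%nat /\ gamma_cond r M (fun p => lambda M p s)) <-> gamma_cond r M (mu M).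
Proof.
assert (Hri : 0 <= / INR r) by (left; apply Rinv_0_lt_compat, lt_0_INR; lia).
assert (Hpos : forall p k, 0 <= / root r M (p + k)).
{ intros; left; apply Rinv_0_lt_compat, root_pos. }
split.
- intros [s [Hs Hg]]; apply gamma_cond_iff in Hg; destruct Hg as [A HA].
  assert (Hs0 : 0 < INR s) by (apply lt_0_INR; lia).
  assert (Hs2 : 0 < / INR s ^ 2) by (apply Rinv_0_lt_compat, pow_lt, Hs0).
  set (sigma := Rpower (/ INR s ^ 2) (/ INR r)).
  assert (Hsigma : 0 < sigma) by apply exp_pos.
  (* The terms from q to 2q - 1 are at most [/ root r M q] and contribute 1; the rest is (iii) at
     2q, whence the factor 2. *)
  apply gamma_cond_mu_iff; exists (1 + 2 * A / sigma); intros q n Hq.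
  assert (Hq0 : 0 < INR q) by (apply lt_0_INR; lia).
  pose proof (LC_pos _ HM) as HMp.
  assert (Hlam : / INR s ^ 2 * mu M q <= lambda M (q + q) s).
  { destruct (lambda_lub (q + q) s ltac:(lia) Hs) as [[Hub _] _].
    specialize (Hub _ (ex_intro _ q (conj (ltac:(lia) : (q < q + q)%nat) eq_refl))).
    simpl in Hub; eapply Rle_trans; [|exact Hub].
    replace (q + q - q)%nat with q by lia.
    assert (Hb : 0 < / INR s ^ 2 * mu M q) by (apply Rmult_lt_0_compat; [exact Hs2 | apply mu_pos]).
    rewrite <- (Rpower_1 (/ INR s ^ 2 * mu M q)) by exact Hb.
    rewrite <- (Rinv_r (INR q)) at 1 by lra.
    rewrite <- Rpower_mult, Rpower_pow by exact Hb.
    apply Rle_Rpower_l; [left; now apply Rinv_0_lt_compat|]; split; [now apply pow_lt|].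
    pose proof (pow_lt _ (q + q) Hs0) as Hsq; pose proof (HMp q) as HMq.
    apply (Rle_div_r _ _ (INR s ^ (q + q) * M q)); [now apply Rmult_lt_0_compat|].
    rewrite Rpow_mult_distr, pow_inv, <- pow_mult.
    replace (2 * q)%nat with (q + q)%nat by lia.
    replace (/ INR s ^ (q + q) * mu M q ^ q * (INR s ^ (q + q) * M q))
      with (M q * mu M q ^ q) by (field; lra).
    apply M_ge_mu. }
  assert (Hroot : sigma * root r M q <= Rpower (lambda M (q + q) s) (/ INR r)).
  { unfold sigma, root; rewrite Rpower_mult_distr; [|exact Hs2 | apply mu_pos].
    apply Rle_Rpower_l; [exact Hri|]; split; [|exact Hlam].
    apply Rmult_lt_0_compat; [exact Hs2 | apply mu_pos]. }
  pose proof (HA (q + q)%nat n ltac:(lia)) as H1; rewrite plus_INR in H1.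
  pose proof (root_pos r M q) as Hrq.
  assert (H0 : 0 <= psum (fun k => / root r M (q + q + k)) n) by (apply psum_nonneg; auto).
  assert (H2 : root r M q * psum (fun k => / root r M (q + q + k)) n <= 2 * A / sigma * INR q).
  { replace (2 * A / sigma * INR q) with (A * (INR q + INR q) / sigma) by (field; lra).
    apply (Rle_div_r _ _ _ Hsigma); eapply Rle_trans; [|exact H1].
    apply Rmult_le_compat_r with (r := psum (fun k => / root r M (q + q + k)) n) in Hroot; lra. }
  assert (H3 : psum (fun k => / root r M (q + k)) n
    <= INR q * / root r M q + psum (fun k => / root r M (q + q + k)) n).
  { eapply Rle_trans; [apply (psum_mono _ n (q + n)); [auto | lia]|].
    rewrite psum_add; apply Rplus_le_compat.
    - rewrite <- psum_const; apply psum_le; intros k _.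
      apply Rinv_le_contravar; [apply root_pos | apply root_mono; lia].
    - apply psum_le; intros k _; rewrite Nat.add_assoc; lra. }
  apply Rmult_le_compat_l with (r := root r M q) in H3; [|lra].
  rewrite Rmult_plus_distr_l in H3.
  replace (root r M q * (INR q * / root r M q)) with (INR q) in H3 by (field; lra).
  lra.
- intros Hg; apply gamma_cond_iff in Hg; destruct Hg as [A HA].
  exists 1%nat; split; [lia|]; apply gamma_cond_iff; exists A; intros p n Hp.
  eapply Rle_trans; [|apply (HA p n Hp)].
  apply Rmult_le_compat_r; [apply psum_nonneg; auto|].
  destruct (lambda_lub p 1 Hp (le_n _)) as [[Hub _] Hle].
  apply Rle_Rpower_l; [exact Hri|]; split; [|exact Hle].
  specialize (Hub _ (ex_intro _ O (conj (Nat.lt_le_trans _ _ _ Nat.lt_0_1 Hp) eq_refl))).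
  simpl in Hub; eapply Rlt_le_trans; [apply exp_pos | exact Hub].
Qed.

Lemma Lambda_h_le h a : 0 < h ->
  Lambda_h M h a <-> exists B, forall n, Cmod (a n) <= B * (h ^ n * M n).
Proof.
intros Hh; split; intros [B HB]; exists B; intros n; specialize (HB n);
  (assert (0 < h ^ n * M n) by (apply Rmult_lt_0_compat; [now apply pow_lt | apply (LC_pos _ HM)]));
  [now apply Rle_div_l in HB | now apply Rle_div_l].
Qed.

Lemma Borel_Roumieu_onto : gamma_cond r M (mu M) ->
  Borel_surjective r (D_Roumieu r M) (Lambda_Roumieu M).
Proof.
intros Hg; apply gamma_cond_mu_iff in Hg; destruct Hg as [A HA].
intros a [H [HH Ha]]; apply Lambda_h_le in Ha; [|exact HH]; destruct Ha as [B HB].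
destruct (extension_complex r (root r M) A H Hr (root_pos r M) root_incr HA HH)
  as [h [Hh Hext]].
destruct (Hext B a) as [f [C [Hf [Hb Hbd]]]].
{ intros n; rewrite weight_root; apply HB. }
exists f; split; [|exact Hb]; split; [exact Hf|].
exists h; split; [exact Hh|]; exists C; intros n x.
apply Rle_div_l; [apply Rmult_lt_0_compat; [now apply pow_lt | apply (LC_pos _ HM)]|].
rewrite <- (weight_root n); apply Hbd.
Qed.

(** For Beurling data, |a n| / M n decays faster than any geometric sequence, which is the input of
    [smaller_weight]. Relative to the new weight the data have rate 1, and comparing the weights at
    rate [h' / h] turns the resulting rate [h] into any [h']. *)
Lemma Borel_Beurling_onto : gamma_cond r M (mu M) ->
  Borel_surjective r (D_Beurling r M) (Lambda_Beurling M).
Proof.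
intros Hg; apply gamma_cond_mu_iff in Hg; destruct Hg as [A HA]; intros a Ha.
pose proof (LC_pos _ HM) as HMp.
destruct (smaller_weight r (root r M) (fun n => Cmod (a n) / M n) A Hr (root_pos r M) root_incr HA)
  as [m' [m'pos [m'incr [Ht [[B HB] Hsmall]]]]].
{ intros n; apply Rle_mult_inv_pos; [apply Cmod_ge_0 | apply HMp]. }
{ intros eps Heps; destruct (proj1 (Lambda_h_le eps a Heps) (Ha eps Heps)) as [B HB].
  exists B; intros n; apply Rle_div_l; [apply HMp|]; specialize (HB n); lra. }
destruct (extension_complex r m' (4 * A) 1 Hr m'pos m'incr Ht Rlt_0_1) as [h [Hh Hext]].
destruct (Hext B a) as [f [C [Hf [Hb Hbd]]]].
{ intros n; specialize (HB n); rewrite weight_root in HB; rewrite pow1, Rmult_1_l.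
  replace (Cmod (a n)) with (Cmod (a n) / M n * M n) by (field; apply Rgt_not_eq, HMp).
  exact HB. }
exists f; split; [|exact Hb]; split; [exact Hf|].
intros h' Hh'; destruct (Hsmall (h' / h)) as [C' HC']; [now apply Rdiv_lt_0_compat|].
exists (Rabs C * C'); intros n x.
apply Rle_div_l; [apply Rmult_lt_0_compat; [now apply pow_lt | apply HMp]|].
specialize (HC' n); rewrite weight_root in HC'.
pose proof (pow_lt _ n Hh) as Hhn; pose proof (weight_pos r m' m'pos (r * n)) as Hwn.
apply Rle_trans with (Rabs C * (h ^ n * weight r m' (r * n))).
- eapply Rle_trans; [apply Hbd|]; apply Rmult_le_compat_r; [|apply Rle_abs].
  apply Rmult_le_pos; lra.
- rewrite Rmult_assoc; apply Rmult_le_compat_l; [apply Rabs_pos|].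
  replace (C' * (h' ^ n * M n)) with (h ^ n * (C' * ((h' / h) ^ n * M n))).
  + apply Rmult_le_compat_l; lra.
  + unfold Rdiv; rewrite Rpow_mult_distr, pow_inv; field; lra.
Qed.

End LogConvex.

(** * Flat functions *)

Lemma exp_le x y : x <= y -> exp x <= exp y.
Proof. intros [H| ->]; [left; now apply exp_increasing | apply Rle_refl]. Qed.

Lemma le_of_derive_nonneg (g dg : R -> R) t : 0 <= t ->
  (forall x, is_derive g x (dg x)) -> (forall x, 0 <= x <= t -> 0 <= dg x) -> g 0 <= g t.
Proof.
intros Ht Hd Hp.
destruct (MVT_gen g 0 t dg) as [c [Hc E]].
- intros x _; apply Hd.
- intros x _; apply derivable_continuous_pt; exists (dg x); apply is_derive_Reals, Hd.
- rewrite Rmin_left, Rmax_right in Hc by lra.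
  pose proof (Hp c Hc); nra.
Qed.

Lemma exp_majorant_primitive (v dv : R -> R) B s : 0 < s ->
  (forall x, is_derive v x (dv x)) -> v 0 = 0 ->
  (forall x, 0 <= x -> Rabs (dv x) <= B * exp (s * x)) ->
  forall x, 0 <= x -> Rabs (v x) <= B / s * exp (s * x).
Proof.
intros Hs Hd H0 Hb x Hx.
assert (HB : 0 <= B).
{ pose proof (Hb 0 (Rle_refl 0)) as H; rewrite Rmult_0_r, exp_0 in H.
  pose proof (Rabs_pos (dv 0)); lra. }
assert (HBs : 0 <= B / s) by now apply Rle_mult_inv_pos.
assert (HE : forall y, is_derive (fun y => B / s * exp (s * y)) y (B * exp (s * y))).
{ intros y; auto_derive; [exact I|]; field; lra. }
apply Rabs_le; split.
- pose proof (le_of_derive_nonneg (fun y => B / s * exp (s * y) + v y)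
    (fun y => B * exp (s * y) + dv y) x Hx) as H; cbv beta in H.
  rewrite H0, Rmult_0_r, exp_0 in H.
  assert (B / s * 1 + 0 <= B / s * exp (s * x) + v x); [|lra]; apply H.
  + intros y; apply (is_derive_plus (fun y => B / s * exp (s * y)) v); [apply HE | apply Hd].
  + intros y Hy; pose proof (Hb y ltac:(lra)) as Hy'; apply Rabs_le_between in Hy'; lra.
- pose proof (le_of_derive_nonneg (fun y => B / s * exp (s * y) - v y)
    (fun y => B * exp (s * y) - dv y) x Hx) as H; cbv beta in H.
  rewrite H0, Rmult_0_r, exp_0 in H.
  assert (B / s * 1 - 0 <= B / s * exp (s * x) - v x); [|lra]; apply H.
  + intros y; apply (is_derive_minus (fun y => B / s * exp (s * y)) v); [apply HE | apply Hd].
  + intros y Hy; pose proof (Hb y ltac:(lra)) as Hy'; apply Rabs_le_between in Hy'; lra.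
Qed.

(** Each integration from 0 gains a factor [/ s]; [r] of them lead from order [r] to order 0. *)
Lemma exp_majorant (r : nat) (v : nat -> R -> R) B s : 0 < s ->
  (forall i x, is_derive (v i) x (v (S i) x)) -> (forall i, (i < r)%nat -> v i 0 = 0) ->
  (forall x, 0 <= x -> Rabs (v r x) <= B * exp (s * x)) ->
  forall x, 0 <= x -> Rabs (v O x) <= B / s ^ r * exp (s * x).
Proof.
intros Hs; revert v; induction r as [|r IH]; intros v Hd H0 Hb x Hx.
- simpl; unfold Rdiv; rewrite Rinv_1, Rmult_1_r; now apply Hb.
- replace (B / s ^ S r) with (B / s ^ r / s)
    by (simpl; field; split; [apply pow_nonzero|]; lra).
  apply (exp_majorant_primitive (v O) (v 1%nat)); auto; [apply H0; lia|].
  apply (IH (fun i => v (S i))); auto; intros i Hi; apply H0; lia.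
Qed.

(* A quantitative Denjoy-Carleman estimate in the manner of Bang: a bound by
   [Q (S k)] improves to an exponential one below the point
   [psum (fun k => / s (S (S k))) K]; integrating it [r] times pays for the step
   [/ s 1] to the next point. *)
Lemma flat_decay (r K : nat) (w : nat -> R -> R) (Q s : nat -> R) :
  (forall i x, is_derive (w i) x (w (S i) x)) ->
  (forall i, (i < r * K)%nat -> w i 0 = 0) ->
  (forall k x, 0 <= x -> Rabs (w (r * k)%nat x) <= Q k) ->
  (forall k, 0 < s k) -> (forall k, s k <= s (S k)) ->
  (forall k, Q (S k) * exp 1 <= Q k * s (S k) ^ r) ->
  forall x, 0 <= x ->
    Rabs (w O x) <= Q O * exp (s 1%nat * (x - psum (fun k => / s (S k)) K)).
Proof.
revert w Q s; induction K as [|K IH]; intros w Q s Hd H0 HQ Hs Hss Hratio x Hx.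
- specialize (HQ O x Hx); rewrite Nat.mul_0_r in HQ; simpl.
  rewrite <- (Rmult_1_r (Q O)) in HQ; eapply Rle_trans; [exact HQ|].
  apply Rmult_le_compat_l.
  { pose proof (Rabs_pos (w O x)); lra. }
  rewrite <- exp_0; apply exp_le; specialize (Hs 1%nat).
  rewrite Rminus_0_r; now apply Rmult_le_pos; [left|].
- set (X := psum (fun k => / s (S (S k))) K).
  assert (HQ1 : 0 <= Q 1%nat).
  { eapply Rle_trans; [apply Rabs_pos | apply (HQ 1%nat 0); lra]. }
  pose proof (Hs 1%nat) as Hs1.
  (* A single exponential of rate [s 1] on all of [0, oo), ready to be integrated. Up to [X] the
     induction hypothesis has the larger rate [s 2] and a nonpositive exponent; beyond [X] the plain
     bound [Q 1] suffices. *)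
  assert (Hw : forall t, 0 <= t ->
    Rabs (w (r + 0)%nat t) <= Q 1%nat * exp (- (s 1%nat * X)) * exp (s 1%nat * t)).
  { intros t Ht; rewrite Rmult_assoc, <- exp_plus.
    destruct (Rle_lt_dec t X) as [HtX|HtX].
    - eapply Rle_trans; [apply (IH (fun i => w (r + i)%nat) (fun k => Q (S k)) (fun k => s (S k)))|].
      + intros i y; rewrite Nat.add_succ_r; apply Hd.
      + intros i Hi; apply H0; lia.
      + intros k y Hy; replace (r + r * k)%nat with (r * S k)%nat by lia; now apply HQ.
      + intros; apply Hs.
      + intros; apply Hss.
      + intros; apply Hratio.
      + exact Ht.
      + fold X; apply Rmult_le_compat_l; [exact HQ1|]; apply exp_le.
        pose proof (Hss 1%nat); nra.
    - rewrite Nat.add_0_r; pose proof (HQ 1%nat t Ht) as H; rewrite Nat.mul_1_r in H.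
      rewrite <- (Rmult_1_r (Q 1%nat)) in H; eapply Rle_trans; [exact H|].
      apply Rmult_le_compat_l; [exact HQ1|]; rewrite <- exp_0; apply exp_le; nra. }
  rewrite Nat.add_0_r in Hw.
  eapply Rle_trans; [apply (exp_majorant r w _ _ Hs1 Hd) with (2 := Hw) (3 := Hx)|].
  { intros i Hi; apply H0; nia. }
  rewrite psum_S_l; fold X.
  (* The summand - 1 produced by the step [/ s 1] is matched by the [exp 1] of the ratio
     hypothesis. *)
  replace (s 1%nat * (x - (/ s 1%nat + X))) with
    (- (s 1%nat * X) + s 1%nat * x + - (1)) by (field; lra).
  rewrite !exp_plus, exp_Ropp.
  assert (Hsr : 0 < s 1%nat ^ r) by now apply pow_lt.
  assert (HE : 0 < exp (- (s 1%nat * X)) * exp (s 1%nat * x))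
    by (apply Rmult_lt_0_compat; apply exp_pos).
  pose proof (exp_pos 1) as He.
  replace (Q 1%nat * / exp (s 1%nat * X) / s 1%nat ^ r * exp (s 1%nat * x))
    with (Q 1%nat * exp 1 / s 1%nat ^ r * (/ exp (s 1%nat * X) * exp (s 1%nat * x) * / exp 1)).
  2:{ field; repeat split; try lra; apply Rgt_not_eq, exp_pos. }
  rewrite (exp_Ropp 1); rewrite exp_Ropp in HE.
  apply Rmult_le_compat_r.
  { apply Rmult_le_pos; [lra | left; now apply Rinv_0_lt_compat]. }
  apply Rle_div_l; [exact Hsr | apply Hratio].
Qed.

Lemma monomial_lower (d : nat) (v : nat -> R -> R) c X :
  (forall i x, is_derive (v i) x (v (S i) x)) -> (forall i, (i < d)%nat -> v i 0 = 0) ->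
  (forall x, 0 <= x <= X -> c <= v d x) ->
  forall x, 0 <= x <= X -> c * monomial d x <= v O x.
Proof.
revert v; induction d as [|d IH]; intros v Hd H0 Hc x Hx.
- unfold monomial; simpl; specialize (Hc x Hx); lra.
- pose proof (le_of_derive_nonneg (fun y => v O y - c * monomial (S d) y)
    (fun y => v 1%nat y - c * monomial d y) x (proj1 Hx)) as H; cbv beta in H.
  assert (E : monomial (S d) 0 = 0) by (unfold monomial; simpl; unfold Rdiv; ring).
  rewrite E, H0 in H by lia.
  assert (0 - c * 0 <= v O x - c * monomial (S d) x); [|lra]; apply H.
  + intros y; apply (is_derive_minus (v O) (fun y => c * monomial (S d) y)); [apply Hd|].
    apply is_derive_scal, is_derive_monomial.
  + intros y Hy; assert (c * monomial d y <= v 1%nat y); [|lra].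
    apply (IH (fun i => v (S i))); auto; [|lra]; intros i Hi; apply H0; lia.
Qed.

Lemma fact_le_pow d : INR (fact d) <= INR d ^ d.
Proof.
assert (H : forall k, (k <= d)%nat -> INR (fact k) <= INR d ^ k).
{ induction k as [|k IH]; intros Hk; [simpl; lra|].
  rewrite fact_simpl, mult_INR; cbn [pow]; apply Rmult_le_compat.
  - apply pos_INR.
  - apply pos_INR.
  - now apply le_INR.
  - apply IH; lia. }
now apply H.
Qed.

(** Used in contrapositive form: if (iv) fails, it fails by any factor [L] at arbitrarily large [j],
    even for sums starting beyond 2j. Indeed, dropping [d] terms costs at most [d] after
    multiplication by [m p], since [m p <= m k]. *)
Lemma tail_bound_of_eventual (m : nat -> R) L n0 : (forall k, 0 < m k) ->
  (forall k, m k <= m (S k)) -> 0 <= L ->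
  (forall j N, (n0 <= j)%nat -> m j * psum (fun k => / m (j + j + 1 + k)%nat) N <= L * INR j) ->
  exists A, tail_bound m A.
Proof.
intros mpos mincr HL H.
assert (Hpos : forall p k, 0 <= / m (p + k)%nat).
{ intros; left; apply Rinv_0_lt_compat, mpos. }
assert (Hsplit : forall p d n,
  m p * psum (fun k => / m (p + k)%nat) n
    <= INR d + m p * psum (fun k => / m (p + d + k)%nat) n).
{ intros p d n; pose proof (mpos p) as Hp.
  apply Rle_trans with (m p * (INR d * / m p + psum (fun k => / m (p + d + k)%nat) n)).
  - apply Rmult_le_compat_l; [lra|].
    eapply Rle_trans; [apply (psum_mono _ n (d + n)); [auto | lia]|].
    rewrite psum_add; apply Rplus_le_compat.
    + rewrite <- psum_const; apply psum_le; intros k _.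
      apply Rinv_le_contravar; [exact Hp | apply m_mono; [exact mincr | lia]].
    + apply psum_le; intros k _; rewrite Nat.add_assoc; lra.
  - rewrite Rmult_plus_distr_l; rewrite <- Rmult_assoc, (Rmult_comm (m p)), Rmult_assoc, Rinv_r, Rmult_1_r by lra; lra. }
set (J := S n0).
assert (HJ1 : 1 <= INR J) by (apply (le_INR 1); unfold J; lia).
assert (Hbig : forall p n, (J <= p)%nat ->
  m p * psum (fun k => / m (p + k)%nat) n <= (2 + L) * INR p).
{ intros p n Hp; assert (1 <= INR p) by (apply (le_INR 1); unfold J in Hp; lia).
  eapply Rle_trans; [apply (Hsplit p (p + 1)%nat)|]; rewrite Nat.add_assoc, plus_INR; simpl (INR 1).
  pose proof (H p n ltac:(unfold J in Hp; lia)); lra. }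
exists ((3 + L) * INR J); intros p n Hp.
assert (Hp1 : 1 <= INR p) by (apply (le_INR 1); lia).
destruct (Nat.le_gt_cases J p) as [HJp|HJp].
- eapply Rle_trans; [now apply Hbig|].
  apply Rmult_le_compat_r; [lra | nra].
- eapply Rle_trans; [apply (Hsplit p (J - p)%nat)|].
  replace (p + (J - p))%nat with J by lia.
  assert (HpJ : INR (J - p) <= INR J) by (apply le_INR; lia).
  assert (H0 : 0 <= psum (fun k => / m (J + k)%nat) n) by (apply psum_nonneg; auto).
  pose proof (m_mono m mincr p J ltac:(lia)) as Hm.
  pose proof (Hbig J n (le_n _)) as HbJ.
  assert (m p * psum (fun k => / m (J + k)%nat) n <= (2 + L) * INR J) by nra.
  apply Rle_trans with ((3 + L) * INR J); [lra|].
  assert (0 <= (3 + L) * INR J) by (apply Rmult_le_pos; lra); nra.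
Qed.

(** * A single prescribed derivative of order 2rj *)

Section Necessity.

Variables (r : nat) (M : nat -> R).
Hypothesis Hr : (1 <= r)%nat.
Hypothesis HM : LC M.

(** If the sum were larger, the derivative of order 2rj would keep half its value at 0 up to [x0].
    The derivative of order rj would then exceed A h^j M_j at [x0], because m_j x0 / (rj) is above 2
    A h / eps^2. *)
Lemma isolated_coefficient (u : nat -> R -> R) A h eps j N :
  1 <= A -> 1 <= h -> 0 < eps <= 1 -> (1 <= j)%nat ->
  (forall i x, is_derive (u i) x (u (S i) x)) ->
  (forall k x, Rabs (u (r * k)%nat x) <= A * (h ^ k * M k)) ->
  u (r * (j + j))%nat 0 = eps ^ (j + j) * M (j + j)%nat ->
  (forall i, (r * j <= i < r * (j + j + N))%nat -> i <> (r * (j + j))%nat -> u i 0 = 0) ->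
  root r M j * psum (fun k => / root r M (j + j + 1 + k)) N
    <= 12 * INR r * A * h ^ 2 / eps ^ 2 * INR j.
Proof.
intros HA Hh Heps Hj Hd Hb Ha H0; apply Rnot_lt_le; intros Hlt.
pose proof (LC_pos _ HM) as HMp.
set (n := (j + j)%nat) in *.
set (T := psum (fun k => / root r M (n + 1 + k)) N) in *.
(* The 12 makes [L / (2 * kappa * INR r)] equal to 2 A h / eps^2, as needed in the final
   comparison. *)
set (L := 12 * INR r * A * h ^ 2 / eps ^ 2) in *.
assert (Hr1 : 1 <= INR r) by (apply (le_INR 1); exact Hr).
assert (Hj1 : 1 <= INR j) by (apply (le_INR 1); exact Hj).
assert (Heps2 : 0 < eps ^ 2) by (apply pow_lt; lra).
assert (Hh2 : 1 <= h ^ 2) by (apply pow_R1_Rle; lra).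
assert (HL : L * eps ^ 2 = 12 * INR r * A * h ^ 2) by (unfold L; field; lra).
assert (HAh : 1 <= A * h ^ 2) by nra.
assert (HrAh : A * h ^ 2 <= INR r * (A * h ^ 2)) by nra.
assert (HLpos : 0 < L) by (apply Rdiv_lt_0_compat; [nra | exact Heps2]).
pose proof (root_pos r M j) as Hmj.
(* Then kappa^r >= 3 h >= e h, which covers the rate [h] and the factor [exp 1] in the ratio
   hypothesis of [flat_decay]. *)
set (kappa := 3 * h).
assert (Hkappa : 3 <= kappa) by (unfold kappa; lra).
set (a := eps ^ n * M n).
set (w := fun i x => u (r * n + i)%nat x - (if Nat.eqb i 0 then a else 0)).
assert (Hdecay : forall x, 0 <= x -> Rabs (u (r * n)%nat x - a)
  <= 2 * A * (h ^ n * M n) * exp (kappa * root r M (n + 1) * (x - T / kappa))).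
{ intros x Hx.
  pose proof (flat_decay r N w (fun k => 2 * A * (h ^ (n + k) * M (n + k)%nat))
    (fun k => kappa * root r M (n + k))) as HF.
  cbv beta in HF; rewrite Nat.add_0_r in HF.
  replace (psum (fun k => / (kappa * root r M (n + S k))) N) with (T / kappa) in HF.
  2:{ unfold T, Rdiv; rewrite Rmult_comm, <- psum_scal; apply psum_ext; intros k _.
      rewrite Rinv_mult; do 3 f_equal; lia. }
  replace (u (r * n)%nat x - a) with (w O x) by (unfold w; rewrite Nat.add_0_r; reflexivity).
  apply HF; clear HF; auto.
  - intros i y; unfold w; rewrite Nat.add_succ_r; simpl (Nat.eqb (S i) 0).
    apply (is_derive_minus (u (r * n + i)%nat) (fun _ => if Nat.eqb i 0 then a else 0));
      [apply Hd | apply (is_derive_const (K := R_AbsRing) (V := R_NormedModule))].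
  - intros [|i] Hi; unfold w; simpl (Nat.eqb _ 0).
    + rewrite Nat.add_0_r, Ha; apply Rminus_diag.
    + rewrite Rminus_0_r; apply H0; unfold n in *; nia.
  - intros k y _; unfold w.
    replace (r * n + r * k)%nat with (r * (n + k))%nat by lia.
    pose proof (Hb (n + k)%nat y) as Hy.
    assert (Hak : Rabs (if Nat.eqb (r * k) 0 then a else 0) <= A * (h ^ (n + k) * M (n + k)%nat)).
    { destruct (Nat.eqb_spec (r * k) 0) as [E|E].
      - replace k with O by nia; rewrite Nat.add_0_r; unfold a; rewrite <- Ha; apply Hb.
      - rewrite Rabs_R0; eapply Rle_trans; [apply Rabs_pos | exact Hy]. }
    unfold Rminus; eapply Rle_trans; [apply Rabs_triang|]; rewrite Rabs_Ropp; lra.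
  - intros k; apply Rmult_lt_0_compat; [lra | apply root_pos].
  - intros k; apply Rmult_le_compat_l; [lra|]; rewrite Nat.add_succ_r; now apply root_incr.
  - intros k; rewrite Nat.add_succ_r, Rpow_mult_distr, root_pow, (mu_succ _ HM) by assumption.
    pose proof (HMp (n + k)%nat) as HMn; pose proof (mu_pos _ HM (S (n + k))) as Hmun.
    assert (Hhn : 0 < h ^ (n + k)) by (apply pow_lt; lra).
    assert (Hkr : h * exp 1 <= kappa ^ r).
    { apply Rle_trans with (kappa ^ 1); [unfold kappa; pose proof exp_le_3; simpl; nra|].
      apply Rle_pow; [lra | exact Hr]. }
    replace (2 * A * (h ^ S (n + k) * (M (n + k)%nat * mu M (S (n + k)))) * exp 1)
      with (2 * A * (h ^ (n + k) * M (n + k)%nat) * ((h * exp 1) * mu M (S (n + k))))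
      by (cbn [pow]; ring).
    apply Rmult_le_compat_l.
    { repeat apply Rmult_le_pos; lra. }
    apply Rmult_le_compat_r; lra. }
(* Half the length [T / kappa] on which [Hdecay] has a negative exponent; on [0, x0] the exponent is
   thus at most - L j / 2. *)
set (x0 := T / (2 * kappa)).
assert (HT : 0 < T).
{ apply Rmult_lt_reg_l with (root r M j); [exact Hmj|]; nra. }
assert (Hx0 : 0 < x0) by (apply Rdiv_lt_0_compat; lra).
assert (Hhalf : 4 * A * h ^ n * exp (- (L * INR j / 2)) <= eps ^ n).
{ assert (E : exp (- (L * INR j / 2)) = exp (- (L / 2)) ^ j).
  { rewrite <- exp_nat; f_equal; field. }
  assert (Hn : n = (2 * j)%nat) by (unfold n; lia).
  rewrite E, Hn, !pow_mult.
  assert (HeL : exp (- (L / 2)) * (4 * A * h ^ 2) <= eps ^ 2).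
  { rewrite exp_Ropp, Rmult_comm; apply Rle_div_l; [apply exp_pos|].
    pose proof (exp_ineq1_le (L / 2)).
    apply Rle_trans with (eps ^ 2 * (L / 2)); [lra|].
    apply Rmult_le_compat_l; lra. }
  assert (H4A : 4 * A <= (4 * A) ^ j).
  { apply Rle_trans with ((4 * A) ^ 1); [simpl; lra | apply Rle_pow; [lra | exact Hj]]. }
  pose proof (exp_pos (- (L / 2))) as He.
  apply Rle_trans with ((exp (- (L / 2)) * (4 * A * h ^ 2)) ^ j).
  - rewrite !Rpow_mult_distr.
    rewrite <- Rpow_mult_distr.
    assert (0 < (h ^ 2) ^ j) by (apply pow_lt; lra).
    assert (0 < exp (- (L / 2)) ^ j) by now apply pow_lt.
    rewrite Rmult_assoc, (Rmult_comm _ (exp (- (L / 2)) ^ j)), (Rmult_comm (4 * A)).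
    rewrite Rmult_assoc; apply Rmult_le_compat_l; [lra|].
    rewrite Rmult_comm; apply Rmult_le_compat_r; lra.
  - apply pow_incr; split; [|exact HeL].
    apply Rmult_le_pos; [lra|]; nra. }
assert (Hlow : forall x, 0 <= x <= x0 -> a / 2 <= u (r * n)%nat x).
{ intros x Hx; pose proof (Hdecay x (proj1 Hx)) as H1.
  assert (Hm : root r M j <= root r M (n + 1)) by (apply root_mono; auto; unfold n; lia).
  assert (Hexp : exp (kappa * root r M (n + 1) * (x - T / kappa)) <= exp (- (L * INR j / 2))).
  { apply exp_le.
    assert (E : T / kappa = 2 * x0) by (unfold x0; field; lra).
    assert (E2 : kappa * x0 = T / 2) by (unfold x0; field; lra).
    rewrite E.
    apply Rle_trans with (kappa * root r M (n + 1) * (- x0)).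
    - apply Rmult_le_compat_l; [apply Rmult_le_pos; [lra | left; apply root_pos] | lra].
    - replace (kappa * root r M (n + 1) * - x0) with (- (root r M (n + 1) * (kappa * x0))) by ring.
      rewrite E2; nra. }
  assert (HhM : 0 < 2 * A * (h ^ n * M n)).
  { apply Rmult_lt_0_compat; [lra|]; apply Rmult_lt_0_compat; [apply pow_lt; lra | apply HMp]. }
  apply Rmult_le_compat_l with (r := 2 * A * (h ^ n * M n)) in Hexp; [|lra].
  apply Rmult_le_compat_r with (r := M n / 2) in Hhalf; [|pose proof (HMp n); lra].
  assert (Rabs (u (r * n)%nat x - a) <= a / 2) by (unfold a in *; lra).
  apply Rabs_le_between in H; lra. }
assert (Hmono : a / 2 * monomial (r * j) x0 <= u (r * j)%nat x0).
{ pose proof (monomial_lower (r * j) (fun i => u (r * j + i)%nat) (a / 2) x0) as HL'.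
  cbv beta in HL'; rewrite Nat.add_0_r in HL'; apply HL'; [| | |lra].
  - intros i y; rewrite Nat.add_succ_r; apply Hd.
  - intros i Hi; apply H0; unfold n; nia.
  - intros y Hy; replace (r * j + r * j)%nat with (r * n)%nat by (unfold n; lia); now apply Hlow. }
pose proof (Rle_trans _ _ _ Hmono (Rle_trans _ _ _ (Rle_abs _) (Hb j x0))) as Hfin.
assert (Hrj : 0 < INR (r * j)) by (apply lt_0_INR; nia).
set (Lam := L / (2 * kappa * INR r)).
assert (HLam : Lam * eps ^ 2 = 2 * A * h).
{ unfold Lam; replace (L / (2 * kappa * INR r) * eps ^ 2)
    with (L * eps ^ 2 / (2 * kappa * INR r)) by (field; lra).
  rewrite HL; unfold kappa; simpl; field; lra. }
assert (Hm0 : Lam < root r M j * (x0 / INR (r * j))).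
{ unfold Lam, x0; rewrite mult_INR.
  replace (root r M j * (T / (2 * kappa) / (INR r * INR j)))
    with (root r M j * T / INR j / (2 * kappa * INR r)) by (field; lra).
  apply Rmult_lt_compat_r; [apply Rinv_0_lt_compat; nra|].
  apply (Rlt_div_r L _ (INR j)); [lra | exact Hlt]. }
set (X := root r M j * (x0 / INR (r * j))) in *.
assert (HLam1 : 1 <= Lam).
{ apply Rmult_le_reg_r with (eps ^ 2); [exact Heps2|]; rewrite HLam, Rmult_1_l.
  apply Rle_trans with 1; [rewrite <- (pow1 2); apply pow_incr; lra | nra]. }
(* Three losses: M_2j is replaced by M_j (mu_j)^j, (rj)! by (rj)^(rj), and the exponent rj of
   [X >= 1] by j. *)
assert (Hmonx : M j * X ^ j <= M n * monomial (r * j) x0).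
{ assert (Hq : 0 <= (x0 / INR (r * j)) ^ (r * j)).
  { apply pow_le; left; now apply Rdiv_lt_0_compat. }
  apply Rle_trans with (M n * (x0 / INR (r * j)) ^ (r * j)).
  - apply Rle_trans with (M j * mu M j ^ j * (x0 / INR (r * j)) ^ (r * j)).
    + rewrite Rmult_assoc, <- (root_pow M HM r Hr j), <- pow_mult, <- Rpow_mult_distr.
      apply Rmult_le_compat_l; [left; apply HMp|]; fold X; apply Rle_pow; [lra | nia].
    + apply Rmult_le_compat_r; [exact Hq | now apply M_ge_mu].
  - apply Rmult_le_compat_l; [left; apply HMp|].
    unfold Rdiv, monomial; rewrite Rpow_mult_distr; apply Rmult_le_compat_l.
    + apply pow_le; lra.
    + rewrite pow_inv; apply Rinv_le_contravar; [apply INR_fact_lt_0 | apply fact_le_pow]. }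
(* The bound on [u] forces Y^j <= 2 A h^j, whereas Y > 2 A h with 2 A >= 1 forces the opposite. *)
set (Y := eps ^ 2 * X).
assert (HY : 2 * A * h < Y) by (unfold Y; nra).
assert (HYj : Y ^ j <= 2 * A * h ^ j).
{ apply Rmult_le_reg_l with (M j); [apply HMp|].
  assert (En : eps ^ n = (eps ^ 2) ^ j) by (rewrite <- pow_mult; f_equal; unfold n; lia).
  unfold Y; rewrite Rpow_mult_distr.
  apply Rle_trans with ((eps ^ 2) ^ j * (M n * monomial (r * j) x0)).
  - rewrite (Rmult_comm (M j)), Rmult_assoc, (Rmult_comm _ (M j)).
    apply Rmult_le_compat_l; [left; now apply pow_lt | exact Hmonx].
  - unfold a in Hfin; rewrite En in Hfin; lra. }
assert (HY2 : 2 * A * h ^ j < Y ^ j).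
{ destruct j as [|j']; [lia|].
  assert (HAj : 1 <= (2 * A) ^ j') by (apply pow_R1_Rle; lra).
  assert (Hhj : 0 < h ^ j') by (apply pow_lt; lra).
  apply Rle_lt_trans with ((2 * A * h) ^ j' * (2 * A * h)).
  - rewrite Rpow_mult_distr; cbn [pow].
    assert (0 <= h ^ j' * (2 * A * h)) by (repeat apply Rmult_le_pos; lra). nra.
  - cbn [pow]; rewrite (Rmult_comm Y).
    apply Rlt_le_trans with ((2 * A * h) ^ j' * Y).
    + apply Rmult_lt_compat_l; [apply pow_lt; nra | exact HY].
    + apply Rmult_le_compat_r; [nra|]; apply pow_incr; nra. }
lra.
Qed.

End Necessity.

(** * Lacunary data *)

(** Each index is chosen beyond the whole previous block, so the range from [J i] to
    [J i + J i + K i] contains no index [J i' + J i'] with i' different from i. *)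
Lemma lacunary_choice (P : nat -> nat -> nat -> Prop) :
  (forall i n0, exists j N, (n0 <= j)%nat /\ P i j N) ->
  exists J K : nat -> nat, (forall i, P i (J i) (K i)) /\ (forall i, (1 <= J i)%nat) /\
    forall i i', (i < i')%nat -> (J i + J i + K i < J i')%nat.
Proof.
intros H.
assert (H' : forall x : nat * nat, exists y : nat * nat,
  (snd x <= fst y)%nat /\ P (fst x) (fst y) (snd y)).
{ intros [i n0]; destruct (H i n0) as [j [N HjN]]; now exists (j, N). }
destruct (epsilon_choice _ _ _ H') as [next Hnext].
set (st := fix st i := match i with O => next (O, 1%nat)
  | S i' => next (i, S (fst (st i') + fst (st i') + snd (st i'))) end).
exists (fun i => fst (st i)), (fun i => snd (st i)).
assert (Hstep : forall i, (fst (st i) + fst (st i) + snd (st i) < fst (st (S i)))%nat).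
{ intros i; apply (Hnext (S i, S (fst (st i) + fst (st i) + snd (st i)))). }
split; [|split].
- intros [|i]; [apply (Hnext (O, 1%nat)) | apply (Hnext (S i, _))].
- intros [|i]; [apply (Hnext (O, 1%nat)) | specialize (Hstep i); lia].
- intros i i' Hi; induction Hi as [|i' _ IH]; [apply Hstep|].
  specialize (Hstep i'); lia.
Qed.

Lemma gamma_of_preimages (M : nat -> R) (r : nat) : LC M -> (1 <= r)%nat ->
  (forall a, Lambda_Beurling M a -> exists f, D_Roumieu r M f /\ forall j, Borel r f j = a j) ->
  gamma_cond r M (mu M).
Proof.
intros HM Hr Hsurj; pose proof (LC_pos _ HM) as HMp.
apply gamma_cond_mu_iff; [exact HM | exact Hr|]; apply NNPP; intros Hno.
destruct (lacunary_choice (fun i j N => INR (S i) ^ 3 * INR j <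
  root r M j * psum (fun k => / root r M (j + j + 1 + k)) N)) as [J [K [HP [HJ1 HJK]]]].
{ intros i n0; apply NNPP; intros Hn; apply Hno.
  apply (tail_bound_of_eventual (root r M) (INR (S i) ^ 3) n0).
  - apply root_pos.
  - now apply root_incr.
  - apply pow_le, pos_INR.
  - intros j N Hj; apply Rnot_lt_le; intros Hlt; apply Hn; now exists j, N. }
assert (HJ : forall i i', (i < i')%nat -> (J i < J i')%nat).
{ intros i i' Hi; specialize (HJK i i' Hi); lia. }
assert (HJmono : forall i i', (i <= i')%nat -> (J i <= J i')%nat).
{ intros i i' Hi; destruct (Nat.eq_dec i i') as [->|Hne]; [lia|].
  specialize (HJ i i' ltac:(lia)); lia. }
(* [J] is strictly increasing, so at most one [i] determines the value at [p]. *)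
destruct (epsilon_choice nat R (fun p y =>
  (forall i, p = (J i + J i)%nat -> y = (/ INR (S i)) ^ p * M p) /\
  ((forall i, p <> (J i + J i)%nat) -> y = 0))) as [b Hb].
{ intros p; destruct (classic (exists i, p = (J i + J i)%nat)) as [[i Hi]|Hnot].
  - exists ((/ INR (S i)) ^ p * M p); split.
    + intros i' Hi'; replace i' with i; [reflexivity|].
      destruct (Nat.lt_trichotomy i i') as [Hl|[He|Hl]]; [|exact He|];
        specialize (HJ _ _ Hl); lia.
    + intros Hn; now destruct (Hn i).
  - exists 0; split; [|reflexivity]; intros i Hi; exfalso; apply Hnot; now exists i. }
assert (Hbpos : forall i, 0 < / INR (S i)) by (intros; apply Rinv_0_lt_compat, lt_0_INR; lia).
destruct (Hsurj (fun p => RtoC (b p))) as [f [[[Hsm Hsupp Hflat] [h0 [Hh0 [A0 HA0]]]] Hf]].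
{ intros h Hh; apply Lambda_h_le; [exact HM | exact Hh|].
  (* Coefficients with 1 / (i+1) <= h obey the bound with constant 1; the finitely many others have
     order at most 2 J_I and are paid for by c^(2 J_I). *)
  destruct (INR_unbounded (/ h)) as [I HI].
  set (c := Rmax 1 (/ h)); assert (Hc : 1 <= c) by apply Rmax_l.
  exists (c ^ (J I + J I)); intros p; rewrite Cmod_R.
  assert (Hhp : 0 < h ^ p) by now apply pow_lt.
  assert (Hc1 : 1 <= c ^ (J I + J I)) by now apply pow_R1_Rle.
  destruct (classic (exists i, p = (J i + J i)%nat)) as [[i Hi]|Hnot].
  - rewrite (proj1 (Hb p) i Hi), Rabs_pos_eq.
    2:{ apply Rmult_le_pos; [apply pow_le | ]; left; auto. }
    rewrite <- Rmult_assoc; apply Rmult_le_compat_r; [left; apply HMp|].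
    assert (HSi : 1 <= INR (S i)) by (apply (le_INR 1); lia).
    assert (Hle1 : / INR (S i) <= 1) by (rewrite <- Rinv_1; apply Rinv_le_contravar; lra).
    destruct (Nat.le_gt_cases I i) as [HIi|HIi].
    + apply Rle_trans with (1 * h ^ p); [rewrite Rmult_1_l | apply Rmult_le_compat_r; lra].
      apply pow_incr; split; [left; apply Hbpos|].
      rewrite <- (Rinv_inv h); apply Rinv_le_contravar; [now apply Rinv_0_lt_compat|].
      pose proof (le_INR I (S i) ltac:(lia)); lra.
    + apply Rle_trans with (c ^ p * h ^ p).
      * rewrite <- Rpow_mult_distr; apply pow_incr; split; [left; apply Hbpos|].
        apply Rle_trans with 1; [exact Hle1|].
        apply Rle_trans with (/ h * h); [rewrite Rinv_l; lra|].
        apply Rmult_le_compat_r; [lra | apply Rmax_r].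
      * apply Rmult_le_compat_r; [lra|]; apply Rle_pow; [exact Hc|].
        pose proof (HJmono i I ltac:(lia)); lia.
  - rewrite (proj2 (Hb p)), Rabs_R0.
    + repeat apply Rmult_le_pos; [lra | lra | left; apply HMp].
    + intros i Hi; apply Hnot; now exists i. }
set (A := Rmax A0 1); set (h := Rmax h0 1).
assert (HA1 : 1 <= A) by apply Rmax_r.
assert (Hh1 : 1 <= h) by apply Rmax_r.
set (u := fun i x => Re (CDerive_n f i x)).
assert (Hud : forall i x, is_derive (u i) x (u (S i) x)).
{ intros i x; apply is_derive_C, smooth_is_derive, Hsm. }
assert (Hub : forall k x, Rabs (u (r * k)%nat x) <= A * (h ^ k * M k)).
{ intros k x; eapply Rle_trans; [apply re_le_Cmod|].
  pose proof (HA0 k x) as H; apply Rle_div_l in H.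
  2:{ apply Rmult_lt_0_compat; [now apply pow_lt | apply HMp]. }
  eapply Rle_trans; [exact H|].
  assert (Hhk : 0 < h0 ^ k) by now apply pow_lt.
  apply Rle_trans with (A * (h0 ^ k * M k)).
  - apply Rmult_le_compat_r; [|apply Rmax_l].
    apply Rmult_le_pos; [lra | left; apply HMp].
  - apply Rmult_le_compat_l; [lra|]; apply Rmult_le_compat_r; [left; apply HMp|].
    apply pow_incr; split; [lra | apply Rmax_l]. }
assert (Hu0 : forall p, u (r * p)%nat 0 = b p).
{ intros p; specialize (Hf p); unfold Borel in Hf; unfold u; now rewrite Hf. }
assert (Huz : forall i t, (1 <= t < r)%nat -> u (r * i + t)%nat 0 = 0).
{ intros i t Ht; unfold u; now rewrite Hflat. }
(* The block is selected only here, once [A] and [h] are known. *)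
destruct (INR_unbounded (12 * INR r * A * h ^ 2)) as [i Hi].
assert (HSi : 1 <= INR (S i)) by (apply (le_INR 1); lia).
pose proof (isolated_coefficient r M Hr HM u A h (/ INR (S i)) (J i) (K i) HA1 Hh1) as Hiso.
assert (Hcontra : root r M (J i) * psum (fun k => / root r M (J i + J i + 1 + k)) (K i)
  <= 12 * INR r * A * h ^ 2 / (/ INR (S i)) ^ 2 * INR (J i)).
{ apply Hiso; auto.
  - split; [apply Hbpos|]; rewrite <- Rinv_1; apply Rinv_le_contravar; lra.
  - rewrite Hu0; now apply Hb.
  - intros l Hl Hne.
    (* With l = r q + t, flatness at 0 handles t <> 0, and the lacunarity of the blocks handles t =
       0. *)
    assert (Hdiv := Nat.div_mod_eq l r); assert (Hmod := Nat.mod_upper_bound l r ltac:(lia)).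
    set (q := (l / r)%nat) in *; set (t := (l mod r)%nat) in *.
    clearbody q t; rewrite Hdiv; destruct (Nat.eq_dec t 0) as [Ht|Ht]; [|apply Huz; lia].
    rewrite Ht, Nat.add_0_r, Hu0; apply (proj2 (Hb q)); intros i' Hi'.
    rewrite Ht, Nat.add_0_r in Hdiv; subst l.
    assert (Hq1 : (J i <= q)%nat) by (apply (Nat.mul_le_mono_pos_l _ _ r); lia).
    assert (Hq2 : (q < J i + J i + K i)%nat) by (apply (Nat.mul_lt_mono_pos_l r); lia).
    destruct (Nat.lt_trichotomy i i') as [Hl'|[He|Hl']].
    + specialize (HJK _ _ Hl'); lia.
    + subst i'; now rewrite Hi' in Hne.
    + specialize (HJK _ _ Hl'); lia. }
specialize (HP i); cbv beta in HP.
pose proof (Rlt_le_trans _ _ _ HP Hcontra) as Hfin.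
apply Rmult_lt_reg_r in Hfin; [|apply lt_0_INR; specialize (HJ1 i); lia].
rewrite pow_inv in Hfin; unfold Rdiv in Hfin; rewrite Rinv_inv in Hfin.
replace (INR (S i) ^ 3) with (INR (S i) * INR (S i) ^ 2) in Hfin by ring.
apply Rmult_lt_reg_r in Hfin; [|apply pow_lt; lra].
pose proof (le_INR i (S i) ltac:(lia)); lra.
Qed.

Theorem theorem5p2 (r : nat) (M : nat -> R) (hr : (1 <= r)%nat) (hM : LC M)
  (hroot : is_lim_seq
     (fun p => Rpower (Rpower (M p) (/ INR r) / INR (fact p)) (/ INR p)) p_infty) :
  (Borel_surjective r (D_Roumieu r M) (Lambda_Roumieu M) <->
   Borel_surjective r (D_Beurling r M) (Lambda_Beurling M)) /\
  (Borel_surjective r (D_Beurling r M) (Lambda_Beurling M) <->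
   exists s : nat, (1 <= s)%nat /\ gamma_cond r M (fun p => lambda M p s)) /\
  ((exists s : nat, (1 <= s)%nat /\ gamma_cond r M (fun p => lambda M p s)) <->
   gamma_cond r M (mu M)).
Proof.
assert (Hlam := gamma_cond_lambda M hM r hr).
(* A single rate shows that Beurling data are Roumieu data and Beurling functions are Roumieu
   functions, so either surjectivity yields the hypothesis of [gamma_of_preimages]. *)
assert (Hr : Borel_surjective r (D_Roumieu r M) (Lambda_Roumieu M) <-> gamma_cond r M (mu M)).
{ split; [|now apply Borel_Roumieu_onto].
  intros H; apply (gamma_of_preimages M r hM hr); intros a Ha; apply H.
  exists 1; split; [lra | apply Ha; lra]. }
assert (Hb : Borel_surjective r (D_Beurling r M) (Lambda_Beurling M) <-> gamma_cond r M (mu M)).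
{ split; [|now apply Borel_Beurling_onto].
  intros H; apply (gamma_of_preimages M r hM hr); intros a Ha.
  destruct (H a Ha) as [f [[Hf1 Hf2] Hf3]]; exists f; split; [|exact Hf3].
  split; [exact Hf1|]; exists 1; split; [lra | apply Hf2; lra]. }
tauto.
Qed.
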